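(* Consider the short hashing model in which the projection matrix $\mathcal{P}$ is a $k\times n$ Toeplitz matrix of independent standard Gaussians. Let $p,r\in\mathbb{R}^n$ be $L_2$-normalized vectors with angle $\theta_{p,r}$ between them. Then for every $c>0$, $$\mathbb{P}\Big(\big|\tilde{\theta}^{n}_{p,r}-\tfrac{\theta_{p,r}}{\pi}\big|\ge c\Big(\tfrac{\sqrt{\log k}}{k}\Big)^{\frac13}\Big)=O\Big(\frac{1}{c^{2}}\Big),$$ with an absolute implied constant.
   Context: Let $k\le n$, $t=n+k-1$, and $g_1,\dots,g_t$ independent $\mathcal{N}(0,1)$. The Toeplitz projection matrix is $\mathcal{P}_{i,j}=g_{j-i+k}$ for $1\le i\le k$, $1\le j\le n$. Let $\mathcal{D}$ be an $n\times n$ diagonal matrix with independent uniform $\{-1,1\}$ diagonal entries, independent of the $g_l$. With $\mathrm{sign}(x)=1$ for $x\ge0$ and $-1$ for $x<0$ (coordinatewise), the short hashing model is $h(x)=\mathrm{sign}(\mathcal{P}\mathcal{D}x)\in\{-1,1\}^k$, and the normalized approximate angle is $\tilde{\theta}^{n}_{p,r}=\frac{1}{2k}\|h(p)-h(r)\|_1$.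
   Formalization: The claim is stated for k ≥ 2 only: for k = 1 one has log k = 0, so the threshold is 0, the event has probability 1, and no bound O(1/c²) with an absolute constant can hold for all c > 0. *)

(* Defs.v *)
From HB Require Import structures.
From mathcomp Require Import all_boot all_order all_algebra.
From mathcomp Require Import all_classical all_reals all_analysis.
Set Implicit Arguments. Unset Strict Implicit. Unset Printing Implicit Defensive.
Import Order.TTheory GRing.Theory Num.Theory.
Local Open Scope classical_set_scope.
Local Open Scope ring_scope.

Section short_hashing.
Context {d : measure_display} {Omega : measurableType d} {R : realType}.
Variable P : probability Omega R.

Definition mutually_independent {I : finType} (X : I -> {RV P >-> R}) : Prop :=
  forall B : I -> set R, (forall i, measurable (B i)) ->
    P (\bigcap_(i in [set: I]) (X i @^-1` B i)) =
    (\prod_(i : I) P (X i @^-1` B i))%E.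

Definition std_gaussian (X : {RV P >-> R}) : Prop :=
  forall B : set R, measurable B -> P (X @^-1` B) = normal_prob 0 1 B.

Definition rademacher (X : {RV P >-> R}) : Prop :=
  P (X @^-1` [set 1]) = (2^-1)%:E /\ P (X @^-1` [set -1]) = (2^-1)%:E.

End short_hashing.

Section model.
Context {R : realType}.

Definition sgn (x : R) : R := if 0 <= x then 1 else -1.

(** 0-based Toeplitz lookup: entry (i,j) of the k x n matrix is g_{j-i+k}
    (1-based), i.e. g at 0-based index j + k - 1 - i, among t = n+k-1 values. *)
Definition toeplitz (n k : nat) (g : 'I_(n + k - 1) -> R) (i : 'I_k) (j : 'I_n) : R :=
  match @insub nat (fun l => l < n + k - 1)%N _ (j + k - 1 - i)%N with
  | Some l => g l
  | None => 0
  end.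

(** Short hashing h(x) = sign(P D x), with D = diag(dg). *)
Definition short_hash (n k : nat) (g : 'I_(n + k - 1) -> R) (dg : 'I_n -> R)
    (x : 'rV[R]_n) (i : 'I_k) : R :=
  sgn (\sum_(j < n) toeplitz g i j * dg j * x ord0 j).

Definition approx_angle (n k : nat) (g : 'I_(n + k - 1) -> R) (dg : 'I_n -> R)
    (p r : 'rV[R]_n) : R :=
  (2 * k%:R)^-1 * \sum_(i < k) `|short_hash g dg p i - short_hash g dg r i|.

Definition dotv (n : nat) (p r : 'rV[R]_n) : R := \sum_(j < n) p ord0 j * r ord0 j.

(** Angle between two L2-normalized vectors. *)
Definition angle (n : nat) (p r : 'rV[R]_n) : R := acos (dotv p r).

End model.

(* Main.v *)
(** Condition on the signs [D].  Pick a unit vector [q] orthogonal to [p] with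
    [r = cos t p + sin t q].  Row [i] contributes the standard planar Gaussian
    [U_i = ((PDp)_i, (PDq)_i)], and [h(p)_i <> h(r)_i] means that [U_i] lies in a
    double wedge of angle [t]; this has probability [t / pi], because wedge
    probability is nonnegative and, by rotation invariance, additive in the angle.

    For [i <> i'] the pair [(U_i, U_i')] is Gaussian in dimension four, with some
    cross-covariance [M]: write [U_i' = M^T U_i + B W] with [B B^T = I - M^T M] and
    [W] standard independent of [U_i].  Comparing densities, replacing [B W] by [W]
    changes probabilities by at most [1 - det B <= |M|^2], and, the closed wedge
    being symmetric under [u -> -u], the shift by [m = M^T U_i] changes them by at
    most [|m|^2 / 2].  So the covariance of two mismatch indicators is at most
    [7 |M|^2]: it is quadratic in [M].

    The entries of [M] are Rademacher chaoses of order two in [D], and the Toeplitz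
    shifts of the unit vectors [p] and [q] make the expectations of [|M|^2] sum to at
    most [4 k] over all pairs of rows.  Hence the mean of the [k] mismatch indicators
    has variance at most [29 / k], and Chebyshev's inequality concludes since
    [k (sqrt (ln k) / k)^(2/3) >= 1]. *)

Require Import Defs.
From HB Require Import structures.
From mathcomp Require Import all_boot all_order all_algebra.
From mathcomp Require Import all_classical all_reals all_analysis.
From mathcomp Require Import measurable_realfun zify ring lra.
Set Implicit Arguments.
Unset Strict Implicit.
Unset Printing Implicit Defensive.
Import Order.TTheory GRing.Theory Num.Theory.
Import numFieldNormedType.Exports.
Local Open Scope classical_set_scope.
Local Open Scope ring_scope.

(** * Gaussian integrals on the line and the plane *)

(** The bound must be quadratic in [M]. The squared entries of [M] are on average at most of order
    [1/k] per pair of rows, so a covariance bound linear in [|M|] would only give a variance of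
    order [k^(-1/2)], which exceeds the square of the required rate for large [k]. The evenness of
    the closed wedge is what removes the first-order effect of the shift [m].

    For fixed signs the joint covariance of two rows may be singular ([b11] or [b22] can vanish), so
    there need not be a density in dimension four. Gaussian laws are therefore represented by
    iterated one-dimensional integrals along a list of vectors, one for each [g_l]; planar rotations
    bring any such list to four vectors in triangular form, and densities are compared only in the
    plane.

    Conditioning on [D] is replaced by intersecting with the [2^n] events on which all signs are
    prescribed. *)

Definition borel_id {R : realType} (x : measurableTypeR R) : R := x.

Lemma measurable_borel_id (R : realType) : measurable_fun setT (@borel_id R).
Proof. by move=> _ Y mY; rewrite setTI. Qed.

HB.instance Definition _ (R : realType) :=
  isMeasurableFun.Build _ _ _ _ (@borel_id R) (@measurable_borel_id R).

(* [normal_prob] lives on [measurableTypeR R], whose measurable structure is not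
   convertible to the canonical one of [R]. *)
Definition std_normal {R : realType} : probability R R :=
  distribution (@normal_prob R 0 1 : probability (measurableTypeR R) R) borel_id.

Section gaussian_integral.
Context {R : realType}.
Local Notation mu := (@lebesgue_measure R).
Local Notation gam := (@std_normal R).
Local Notation phi := (@normal_pdf R 0 1).

Lemma std_normalE (A : set R) : gam A = normal_prob 0 1 A.
Proof. by []. Qed.

(** The Radon-Nikodym derivative of [normal_prob] and the function [normal_pdf] integrate to the
    same value over every measurable set, hence agree almost everywhere and may be exchanged under
    the integral. *)
Lemma ge0_integral_normal_prob (F : R -> \bar R) :
  measurable_fun [set: R] F -> (forall x, 0 <= F x)%E ->
  (\int[gam]_x F x = \int[mu]_x (F x * (phi x)%:E))%E.
Proof.
move=> mF F0.
transitivity (\int[@normal_prob R 0 1]_x F x)%E.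
  by rewrite [LHS]ge0_integral_distribution.
have dom := @normal_prob_dominates R 0 1.
rewrite -(Radon_Nikodym_SigmaFinite.change_of_variables dom)//.
have mRN : measurable_fun setT (Radon_Nikodym_SigmaFinite.f (@normal_prob R 0 1) mu).
  by apply: measurable_int; exact: (Radon_Nikodym_SigmaFinite.f_integrable dom).
apply: ae_eq_integral => //.
- exact: emeasurable_funM.
- apply: emeasurable_funM => //.
  by apply/measurable_EFinP; exact: measurable_normal_pdf.
- apply: ae_eqe_mul2l.
  apply: integral_ae_eq => //.
  + exact: (Radon_Nikodym_SigmaFinite.f_integrable dom).
  + by apply/measurable_EFinP; exact: measurable_normal_pdf.
  + move=> E _ mE; rewrite -Radon_Nikodym_SigmaFinite.f_integral//.
Qed.

Lemma measurable_affine (a b : R) : measurable_fun [set: R] (fun x => a * x + b).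
Proof.
by apply: measurable_funD => //; apply: measurable_funM.
Qed.

(** Uniqueness of Lebesgue measure: the pushforward scaled by [|a|] has the right value on half-open
    intervals. For [a < 0] the preimage of such an interval is half-open on the other side, with the
    same length. *)
Lemma lebesgue_measure_affine (a b : R) (A : set R) : a != 0 -> measurable A ->
  (`|a|%:E * mu ((fun x => a * x + b)%R @^-1` A) = mu A)%E.
Proof.
move=> a0 mA.
have maff := measurable_affine a b.
pose nu : {measure set _ -> \bar R} := mscale (NngNum (normr_ge0 a)) (pushforward mu (fun x : measurableTypeR R => a * x + b : measurableTypeR R)).
transitivity (nu maff A) => //.
apply/esym/lebesgue_measure_unique => // _ [[u v] /= _ <-].
rewrite /nu /= /mscale/=.
have -> : pushforward mu (fun x : measurableTypeR R => a * x + b : measurableTypeR R) `]u, v]%classic =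
   mu (if 0 < a then `](u - b) / a, (v - b) / a]%classic else `[(v - b) / a, (u - b) / a[%classic).
  rewrite /pushforward; congr (mu _).
  case: ifPn => [ap|an]; apply/seteqP; split => x /=; rewrite !in_itv/=.
  - by rewrite ltr_pdivrMr// ler_pdivlMr// => /andP[? ?]; apply/andP; split; lra.
  - by rewrite ltr_pdivrMr// ler_pdivlMr// => /andP[? ?]; apply/andP; split; lra.
  - have {}an : a < 0 by rewrite lt_neqAle a0 leNgt.
    by rewrite ltr_ndivlMr// ler_ndivrMr// => /andP[? ?]; apply/andP; split; lra.
  - have {}an : a < 0 by rewrite lt_neqAle a0 leNgt.
    by rewrite ltr_ndivlMr// ler_ndivrMr// => /andP[? ?]; apply/andP; split; lra.
case: ifPn => [ap|an]; rewrite !lebesgue_measure_itv/= !lte_fin.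
- rewrite ltr_pM2r ?invr_gt0// ltrD2r; case: ifPn => uv; last by rewrite mule0.
  rewrite -!EFinD -EFinM ger0_norm ?ltW//; congr (_%:E); field.
  by rewrite gt_eqF.
- have {}an : a < 0 by rewrite lt_neqAle a0 leNgt.
  rewrite ltr_nM2r ?invr_lt0// ltrD2r; case: ifPn => uv; last by rewrite mule0.
  rewrite -!EFinD -EFinM ltr0_norm//; congr (_%:E); field.
  by rewrite lt_eqF.
Qed.

Lemma ge0_integral_affine (a b : R) (F : R -> \bar R) : a != 0 ->
  measurable_fun [set: R] F -> (forall x, 0 <= F x)%E ->
  (\int[mu]_x F x = `|a|%:E * \int[mu]_x F (a * x + b)%R)%E.
Proof.
move=> a0 mF F0.
pose nu : {measure set _ -> \bar R} := mscale (NngNum (normr_ge0 a)) (pushforward mu (fun x : measurableTypeR R => a * x + b : measurableTypeR R)).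
rewrite (@eq_measure_integral _ _ _ _ (nu (measurable_affine a b)))//; last first.
  by move=> A mA _; rewrite /nu/= /mscale/= lebesgue_measure_affine.
rewrite ge0_integral_mscale//= ge0_integral_pushforward//=.
exact: measurable_affine.
Qed.

Lemma ge0_integral_affineV (a b : R) (F : R -> \bar R) : a != 0 ->
  measurable_fun [set: R] F -> (forall x, 0 <= F x)%E ->
  (\int[mu]_x F (a * x + b)%R = `|a^-1|%:E * \int[mu]_x F x)%E.
Proof.
move=> a0 mF F0.
rewrite (@ge0_integral_affine a^-1 (- b / a)) ?invr_eq0//; last first.
  by apply: (measurableT_comp mF); exact: measurable_affine.
congr (_ * _)%E; apply: eq_integral => x _; congr F; field.
exact: a0.
Qed.

End gaussian_integral.

Section rotation.
Context {R : realType}.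
Local Notation mu := (@lebesgue_measure R).
Local Notation gam := (@std_normal R).
Local Notation phi := (@normal_pdf R 0 1).

Lemma std_normal_pdfE (x : R) : phi x = normal_peak 1 * expR (- (x ^+ 2 / 2)).
Proof.
rewrite normal_pdfE ?oner_eq0// /normal_fun subr0 expr1n; congr (_ * expR _).
by rewrite mulNr.
Qed.

Lemma measurable_std_normal_pdf d (T : measurableType d) (f : T -> R) :
  measurable_fun setT f -> measurable_fun setT (fun x => (phi (f x))%:E).
Proof.
move=> mf; apply/measurable_EFinP; apply: (measurableT_comp _ mf).
exact: measurable_normal_pdf.
Qed.

Lemma measurable_lin2 (a b c : R) :
  measurable_fun setT (fun z : R * R => a * z.1 + b * z.2 + c).
Proof.
apply: measurable_funD => //; apply: measurable_funD; apply: measurable_funM => //.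
Qed.

Lemma measurable_fun_section d1 d2 (T1 : measurableType d1)
    (T2 : measurableType d2) (K : T1 * T2 -> \bar R) x :
  measurable_fun setT K -> measurable_fun setT (fun y => K (x, y)).
Proof. by move=> mK; apply: (measurableT_comp mK); exact: pair1_measurable. Qed.

Lemma ge0_integral2_normal_prob (K : R * R -> \bar R) :
  measurable_fun setT K -> (forall x, 0 <= K x)%E ->
  (\int[gam]_x \int[gam]_y K (x, y) =
   \int[mu]_x \int[mu]_y (K (x, y) * (phi x * phi y)%:E))%E.
Proof.
move=> mK K0.
rewrite ge0_integral_normal_prob.
- apply: eq_integral => x _.
  rewrite ge0_integral_normal_prob//; last exact: measurable_fun_section.
  rewrite -ge0_integralZr//.
  + by apply: eq_integral => y _; rewrite -muleA -EFinM mulrC.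
  + by apply: emeasurable_funM;
     [exact: measurable_fun_section|exact: measurable_std_normal_pdf].
  + by move=> y _; rewrite mule_ge0// lee_fin normal_pdf_ge0.
  + by rewrite lee_fin normal_pdf_ge0.
- exact: (measurable_fun_fubini_tonelli_F (m2 := gam) K).
- by move=> x; exact: integral_ge0.
Qed.

(** The rotation is factored into one-variable substitutions separated by Tonelli. For [c != 0], put
    [u = c x - s y] at fixed [y], so that [s x + c y = (s u + y) / c], and then replace [y] by this
    second coordinate at fixed [u]; the Jacobians [|c^-1|] and [|c|] cancel. For [c = 0] the
    rotation only exchanges the coordinates up to sign. *)
Lemma ge0_integral2_rotation (c s : R) (L : R * R -> \bar R) :
  c ^+ 2 + s ^+ 2 = 1 -> measurable_fun setT L -> (forall x, 0 <= L x)%E ->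
  (\int[mu]_x \int[mu]_y L (x, y) =
   \int[mu]_x \int[mu]_y L (c * x - s * y, s * x + c * y)%R)%E.
Proof.
move=> cs mL L0.
have mlin a b e f : measurable_fun setT
    (fun z : R * R => L (a * z.1 + b * z.2, e * z.1 + f * z.2)).
  apply: (measurableT_comp mL); apply: measurable_fun_pair.
  - by have := measurable_lin2 a b 0; under eq_fun do rewrite addr0.
  - by have := measurable_lin2 e f 0; under eq_fun do rewrite addr0.
have mrot : measurable_fun setT
    (fun z : R * R => L (c * z.1 - s * z.2, s * z.1 + c * z.2)).
  by have := mlin c (- s) s c; under eq_fun do rewrite mulNr.
rewrite [RHS](fubini_tonelli (m1 := mu) (m2 := mu) (fun z : R * R => L (c * z.1 - s * z.2, s * z.1 + c * z.2)))//=.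
have [c0|c0] := eqVneq c 0.
  have s2 : s ^+ 2 = 1 by rewrite -cs c0 expr0n add0r.
  have s0 : s != 0 by apply: contra_eq_neq s2 => ->; rewrite expr0n eq_sym oner_eq0.
  have ns : `|s^-1| = 1.
    by rewrite normfV; apply/eqP; rewrite invr_eq1 -sqr_norm_eq1 s2.
  transitivity (\int[mu]_y \int[mu]_x L (- s * y + 0, x)%R)%E.
    rewrite (@ge0_integral_affineV _ _ _ (fun u => \int[mu]_x L (u, x))%E) ?oppr_eq0//.
    - by rewrite invrN normrN ns mul1e.
    - exact: (measurable_fun_fubini_tonelli_F (m2 := mu) L).
    - by move=> x; exact: integral_ge0.
  apply: eq_integral => y _.
  transitivity (\int[mu]_x L (- s * y + 0, s * x + 0)%R)%E.
    rewrite (@ge0_integral_affineV _ _ _ (fun u => L (- s * y + 0, u)))//.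
    - by rewrite ns mul1e.
    - exact: measurable_fun_section.
  by apply: eq_integral => x _; rewrite c0 !mul0r !addr0 add0r mulNr.
have c1 : c^-1 != 0 by rewrite invr_eq0.
transitivity (\int[mu]_y (`|c^-1|%:E * \int[mu]_u L (u, c^-1 * (s * u + y))%R))%E.
  rewrite ge0_integralZl//; last 2 first.
  - have m : measurable_fun setT (fun z : R * R => L (z.1, c^-1 * (s * z.1 + z.2))).
      have := mlin 1 0 (c^-1 * s) c^-1.
      by under eq_fun do rewrite mul1r mul0r addr0 -mulrA -mulrDr.
    exact: (measurable_fun_fubini_tonelli_G (m1 := mu) _ m).
  - by move=> y _; exact: integral_ge0.
  have m : measurable_fun setT (fun z : R * R => L (z.1, c^-1 * (s * z.1 + z.2))).
    have := mlin 1 0 (c^-1 * s) c^-1.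
    by under eq_fun do rewrite mul1r mul0r addr0 -mulrA -mulrDr.
  rewrite -(fubini_tonelli (m1 := mu) (m2 := mu) (fun z : R * R => L (z.1, c^-1 * (s * z.1 + z.2))))//=.
  rewrite -ge0_integralZl//; last 2 first.
  - exact: (measurable_fun_fubini_tonelli_F (m2 := mu) _ m).
  - by move=> y _; exact: integral_ge0.
  apply: eq_integral => u _.
  transitivity (`|c^-1|%:E * \int[mu]_y L (u, c^-1 * y + c^-1 * s * u)%R)%E; last first.
    by congr (_ * _)%E; apply: eq_integral => y _; congr (L (_, _)); ring.
  rewrite (@ge0_integral_affineV _ _ _ (fun v => L (u, v)))//; last exact: measurable_fun_section.
  by rewrite muleA -EFinM -normrM mulfV// normr1 mul1e.
apply: eq_integral => y _.
rewrite -(@ge0_integral_affineV _ _ (- (s * y)) (fun u => L (u, c^-1 * (s * u + y))))//.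
- apply: eq_integral => x _; congr (L (_, _)).
  have -> : s * (c * x - s * y) + y = s * c * x + (1 - s ^+ 2) * y by ring.
  rewrite -[in 1 - _]cs addrK; field.
  exact: c0.
- apply: (measurableT_comp mL); apply: measurable_fun_pair => //.
  by apply: measurable_funM => //; apply: measurable_funD => //; apply: measurable_funM.
Qed.

Lemma normal_prob2_rotation (c s : R) (K : R * R -> \bar R) :
  c ^+ 2 + s ^+ 2 = 1 -> measurable_fun setT K -> (forall x, 0 <= K x)%E ->
  (\int[gam]_x \int[gam]_y K (x, y) =
   \int[gam]_x \int[gam]_y K (c * x - s * y, s * x + c * y)%R)%E.
Proof.
move=> cs mK K0.
have mrot : measurable_fun setT
    (fun z : R * R => K (c * z.1 - s * z.2, s * z.1 + c * z.2)).
  apply: (measurableT_comp mK); apply: measurable_fun_pair.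
  - by have := measurable_lin2 c (- s) 0; under eq_fun do rewrite addr0 mulNr.
  - by have := measurable_lin2 s c 0; under eq_fun do rewrite addr0.
rewrite ge0_integral2_normal_prob//.
rewrite (@ge0_integral2_rotation c s (fun z => K z * (phi z.1 * phi z.2)%:E)%E)//=.
- have /= -> := ge0_integral2_normal_prob mrot (fun=> K0 _).
  apply: eq_integral => x _; apply: eq_integral => y _; congr (_ * _%:E)%E.
  rewrite !std_normal_pdfE mulrACA [RHS]mulrACA -!expRD; congr (_ * expR _).
  rewrite -!opprD -!mulrDl; congr (- (_ / _)).
  transitivity ((c ^+ 2 + s ^+ 2) * (x ^+ 2 + y ^+ 2)); first by ring.
  by rewrite cs mul1r.
- apply: emeasurable_funM => //; apply/measurable_EFinP; apply: measurable_funM;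
   apply: (measurableT_comp (measurable_normal_pdf _ _)) => //.
- by move=> z; rewrite mule_ge0// lee_fin mulr_ge0 ?normal_pdf_ge0.
Qed.

End rotation.

(** * Four-dimensional Gaussian vectors *)

Section gaussian_operator.
Context {R : realType}.
Local Notation gam := (@std_normal R).
Local Notation vec := (R * R * (R * R))%type.

Lemma measurable_vec d (X : measurableType d) (h : X -> vec) :
  measurable_fun setT (fun x => (h x).1.1) ->
  measurable_fun setT (fun x => (h x).1.2) ->
  measurable_fun setT (fun x => (h x).2.1) ->
  measurable_fun setT (fun x => (h x).2.2) -> measurable_fun setT h.
Proof.
by move=> *; apply/measurable_fun_pairP; split; apply/measurable_fun_pairP.
Qed.

Lemma measurable_vec_coord :
  [/\ measurable_fun setT (fun z : vec => z.1.1),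
      measurable_fun setT (fun z : vec => z.1.2),
      measurable_fun setT (fun z : vec => z.2.1) &
      measurable_fun setT (fun z : vec => z.2.2)].
Proof.
have m1 : measurable_fun setT (fst : vec -> _) by [].
have m2 : measurable_fun setT (snd : vec -> _) by [].
by split; [have := measurableT_comp measurable_fst m1
  |have := measurableT_comp measurable_snd m1
  |have := measurableT_comp measurable_fst m2
  |have := measurableT_comp measurable_snd m2].
Qed.

Lemma measurable_vec_comb d (X : measurableType d) (h k : X -> vec) (f : X -> R) :
  measurable_fun setT h -> measurable_fun setT k -> measurable_fun setT f ->
  measurable_fun setT (fun x => h x + f x *: k x).
Proof.
move=> mh mk mf; have [m1 m2 m3 m4] := measurable_vec_coord.
apply: measurable_vec => /=.
- by apply: measurable_funD; [exact: (measurableT_comp m1)|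
     apply: measurable_funM => //; exact: (measurableT_comp m1)].
- by apply: measurable_funD; [exact: (measurableT_comp m2)|
     apply: measurable_funM => //; exact: (measurableT_comp m2)].
- by apply: measurable_funD; [exact: (measurableT_comp m3)|
     apply: measurable_funM => //; exact: (measurableT_comp m3)].
- by apply: measurable_funD; [exact: (measurableT_comp m4)|
     apply: measurable_funM => //; exact: (measurableT_comp m4)].
Qed.

(* [gauss_ops ys H z] is the expectation of [H (z + g_1 y_1 + ... + g_N y_N)] for
   independent standard Gaussians [g_j]. *)
Definition gauss_op (y : vec) (H : vec -> \bar R) (z : vec) : \bar R :=
  (\int[gam]_x H (z + x *: y)%R)%E.

Definition gauss_ops (ys : seq vec) (H : vec -> \bar R) : vec -> \bar R :=
  foldr gauss_op H ys.

Lemma gauss_ops_cons y ys H :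
  gauss_ops (y :: ys) H = gauss_op y (gauss_ops ys H).
Proof. by []. Qed.

Lemma gauss_op_ge0 y H z : (forall v, 0 <= H v)%E -> (0 <= gauss_op y H z)%E.
Proof. by move=> H0; exact: integral_ge0. Qed.

Lemma measurable_gauss_op y H : measurable_fun setT H -> (forall v, 0 <= H v)%E ->
  measurable_fun setT (gauss_op y H).
Proof.
move=> mH H0.
apply: (measurable_fun_fubini_tonelli_F (m2 := gam)
  (fun zx : vec * R => H (zx.1 + zx.2 *: y))) => //.
by apply: (measurableT_comp mH); exact: measurable_vec_comb.
Qed.

Lemma gauss_ops_ge0 ys H z : (forall v, 0 <= H v)%E -> (0 <= gauss_ops ys H z)%E.
Proof.
by move=> H0; elim: ys z => //= y ys IH z; exact: gauss_op_ge0.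
Qed.

Lemma measurable_gauss_ops ys H : measurable_fun setT H -> (forall v, 0 <= H v)%E ->
  measurable_fun setT (gauss_ops ys H).
Proof.
move=> mH H0; elim: ys => //= y ys IH; apply: measurable_gauss_op => // v.
exact: gauss_ops_ge0.
Qed.

(** Rotating the pair of Gaussian coefficients of [y1] and [y2] is the same as rotating the two
    directions the opposite way. *)
Lemma gauss_op_rotation (c s : R) y1 y2 H : c ^+ 2 + s ^+ 2 = 1 ->
  measurable_fun setT H -> (forall v, 0 <= H v)%E ->
  gauss_op y1 (gauss_op y2 H) =
  gauss_op (c *: y1 + s *: y2) (gauss_op (c *: y2 - s *: y1) H).
Proof.
move=> cs mH H0; apply/funext => z; rewrite /gauss_op.
have mK : measurable_fun setT (fun x : R * R => H (z + x.1 *: y1 + x.2 *: y2)).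
  by apply: (measurableT_comp mH); do 2 apply: measurable_vec_comb => //.
have /= -> := normal_prob2_rotation cs mK (fun=> H0 _).
apply: eq_integral => x1 _; apply: eq_integral => x2 _; congr H.
rewrite -!addrA; congr (_ + _).
rewrite !(scalerBl, scalerDl, scalerDr, scalerBr, scalerA, scalerN, scaleNr) ![x1 * _]mulrC ![x2 * _]mulrC.
by rewrite addrACA; congr (_ + _); rewrite addrC.
Qed.

Lemma gauss_op0 H : gauss_op 0 H = H.
Proof.
apply/funext => z; rewrite /gauss_op.
under eq_integral do rewrite scaler0 addr0.
by rewrite integral_cst//= probability_setT mule1.
Qed.

(** The sums of [a y * b y] over a list, for linear forms [a] and [b], are the covariances of the
    Gaussian vector that the list represents. Preserving them for all pairs of forms stands in for
    preserving the covariance matrix. *)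
Definition linear_form (l : vec -> R) :=
  forall a b u v, l (a *: u + b *: v) = a * l u + b * l v.

(* Givens rotations of pairs of vectors preserve both the Gaussian expectation and
   the Gram sums, and concentrate the linear form [l] on a single vector. *)
Lemma gauss_ops_eliminate (l : vec -> R) (ys : seq vec) : linear_form l ->
  exists y0 zs, [/\ 0 <= l y0, forall z, z \in zs -> l z = 0,
    forall a b, linear_form a -> linear_form b ->
      \sum_(y <- ys) a y * b y = \sum_(y <- y0 :: zs) a y * b y &
    forall H, measurable_fun setT H -> (forall v, 0 <= H v)%E ->
      gauss_ops ys H = gauss_ops (y0 :: zs) H].
Proof.
move=> ll; elim: ys => [|y ys [y0 [zs [l0 lz gr op]]]].
  exists 0, [::]; split => //.
  - by have := ll 0 0 0 0; rewrite !scale0r addr0 !mul0r addr0 => ->.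
  - move=> a b la lb; rewrite big_nil big_seq1.
    by have := la 0 0 0 0; rewrite !scale0r addr0 !mul0r addr0 => ->; rewrite mul0r.
  - by move=> H _ _ /=; rewrite gauss_op0.
(* When [l] vanishes at both vectors the rotation angle is undefined, but either vector can then
   serve as the pivot. *)
have [n0|n0] := eqVneq (l y ^+ 2 + l y0 ^+ 2) 0.
  have : (l y ^+ 2 == 0) && (l y0 ^+ 2 == 0).
    by rewrite -paddr_eq0 ?sqr_ge0// n0.
  rewrite !sqrf_eq0 => /andP[/eqP ly /eqP ly0].
  exists y, (y0 :: zs); split; first by rewrite ly.
  - by move=> z; rewrite inE => /orP[/eqP->//|]; exact: lz.
  - by move=> a b la lb; rewrite big_cons gr// [RHS]big_cons.
  - by move=> H mH H0; rewrite gauss_ops_cons (op _ mH H0).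
set rho := Num.sqrt (l y ^+ 2 + l y0 ^+ 2).
have n1 : 0 < l y ^+ 2 + l y0 ^+ 2 by rewrite lt_neqAle eq_sym n0 addr_ge0 ?sqr_ge0.
have r0 : 0 < rho by rewrite sqrtr_gt0.
have r2 : rho ^+ 2 = l y ^+ 2 + l y0 ^+ 2 by rewrite sqr_sqrtr// ltW.
pose c := l y / rho; pose s := l y0 / rho.
have cs : c ^+ 2 + s ^+ 2 = 1.
  by rewrite /c /s !expr_div_n -mulrDl -r2 mulfV// expf_eq0/= gt_eqF.
exists (c *: y + s *: y0), (c *: y0 - s *: y :: zs); split.
- rewrite ll /c /s mulrAC [X in _ + X]mulrAC -mulrDl divr_ge0 ?ltW//.
- move=> z; rewrite inE => /orP[/eqP->|]; last exact: lz.
  by rewrite -scaleNr ll /c /s; ring.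
- move=> a b la lb; rewrite big_cons gr// !big_cons -scaleNr !la !lb !addrA.
  congr (_ + _).
  transitivity ((c ^+ 2 + s ^+ 2) * (a y * b y + a y0 * b y0)); last by ring.
  by rewrite cs mul1r.
- move=> H mH H0; rewrite gauss_ops_cons (op _ mH H0) !gauss_ops_cons.
  apply: gauss_op_rotation => //; first exact: measurable_gauss_ops.
  by move=> v; exact: gauss_ops_ge0.
Qed.

Definition coord1 (v : vec) : R := v.1.1.
Definition coord2 (v : vec) : R := v.1.2.
Definition coord3 (v : vec) : R := v.2.1.
Definition coord4 (v : vec) : R := v.2.2.

Lemma coord1_lin : linear_form coord1. Proof. by []. Qed.
Lemma coord2_lin : linear_form coord2. Proof. by []. Qed.
Lemma coord3_lin : linear_form coord3. Proof. by []. Qed.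
Lemma coord4_lin : linear_form coord4. Proof. by []. Qed.

Lemma sum_sqr_eq0 (l : vec -> R) (s : seq vec) :
  \sum_(y <- s) l y * l y = 0 -> forall y, y \in s -> l y = 0.
Proof.
move/eqP; rewrite psumr_eq0; last by move=> i _; rewrite -expr2 sqr_ge0.
move=> /allP h y ys; have := h _ ys; rewrite /= mulf_eq0 orbb => /eqP //.
Qed.

(** A Cholesky factorisation of the covariance, obtained by eliminating one coordinate after
    another. The diagonal entries are only nonnegative, so singular covariances are covered. The
    vectors left over after four eliminations are zero and integrate trivially. *)
Lemma gauss_ops_triangular (ys : seq vec) :
  exists c1 c2 c3 c4,
  [/\ [/\ coord1 c2 = 0, coord1 c3 = 0, coord1 c4 = 0, coord2 c3 = 0 & coord2 c4 = 0] /\ coord3 c4 = 0,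
     [/\ 0 <= coord1 c1, 0 <= coord2 c2, 0 <= coord3 c3 & 0 <= coord4 c4],
    forall a b, linear_form a -> linear_form b ->
      \sum_(y <- ys) a y * b y = \sum_(y <- [:: c1; c2; c3; c4]) a y * b y &
    forall H, measurable_fun setT H -> (forall v, 0 <= H v)%E ->
      gauss_ops ys H = gauss_ops [:: c1; c2; c3; c4] H].
Proof.
have [c1 [z1 [p1 k1 g1 o1]]] := gauss_ops_eliminate ys coord1_lin.
have [c2 [z2 [p2 k2 g2 o2]]] := gauss_ops_eliminate z1 coord2_lin.
have [c3 [z3 [p3 k3 g3 o3]]] := gauss_ops_eliminate z2 coord3_lin.
have [c4 [z4 [p4 k4 g4 o4]]] := gauss_ops_eliminate z3 coord4_lin.
(* Later rotations keep the zeros already created: the sum of the squares of [l] over the list is a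
   Gram sum, hence preserved, and it vanishes only if [l] does at every vector. *)
have tr l (s t : seq vec) : linear_form l -> (forall a b, linear_form a -> linear_form b ->
    \sum_(y <- s) a y * b y = \sum_(y <- t) a y * b y) ->
    (forall y, y \in s -> l y = 0) -> forall y, y \in t -> l y = 0.
  move=> ll st s0; apply: sum_sqr_eq0; rewrite -st// big_seq big1// => y ys'.
  by rewrite s0// mul0r.
have k12 := tr _ _ _ coord1_lin g2 k1.
have k12' z : z \in z2 -> coord1 z = 0 by move=> zz; apply: k12; rewrite inE zz orbT.
have k13 := tr _ _ _ coord1_lin g3 k12'.
have k13' z : z \in z3 -> coord1 z = 0 by move=> zz; apply: k13; rewrite inE zz orbT.
have k14 := tr _ _ _ coord1_lin g4 k13'.
have k23 := tr _ _ _ coord2_lin g3 k2.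
have k23' z : z \in z3 -> coord2 z = 0 by move=> zz; apply: k23; rewrite inE zz orbT.
have k24 := tr _ _ _ coord2_lin g4 k23'.
have k34 := tr _ _ _ coord3_lin g4 k3.
have z40 z : z \in z4 -> z = 0.
  move=> zz; have zz' : z \in c4 :: z4 by rewrite inE zz orbT.
  move: (k14 _ zz') (k24 _ zz') (k34 _ zz') (k4 _ zz).
  by case: z {zz zz'} => [[? ?] [? ?]]; rewrite /coord1 /coord2 /coord3 /coord4/= => -> -> -> ->.
exists c1, c2, c3, c4; split => //.
- split; last exact: k34 (mem_head _ _).
  by split; [exact: k12 (mem_head _ _)|exact: k13 (mem_head _ _)|exact: k14 (mem_head _ _)|exact: k23 (mem_head _ _)|exact: k24 (mem_head _ _)].
- move=> a b la lb; rewrite g1// big_cons g2// big_cons g3// big_cons g4// !big_cons big_nil.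
  do 4 congr (_ + _); rewrite big_seq big1// => y /z40 ->.
  by have := la 0 0 0 0; rewrite !scale0r addr0 !mul0r addr0 => ->; rewrite mul0r.
- move=> H mH H0; rewrite (o1 _ mH H0) gauss_ops_cons (o2 _ mH H0).
  rewrite gauss_ops_cons (o3 _ mH H0) gauss_ops_cons (o4 _ mH H0) !gauss_ops_cons.
  suff -> : gauss_ops z4 H = H by [].
  elim: z4 z40 {k4 g4 o4 k14 k24 k34} => // z z4 IH z40.
  rewrite gauss_ops_cons IH; last by move=> w wz; apply: z40; rewrite inE wz orbT.
  by rewrite (z40 z) ?mem_head// gauss_op0.
Qed.

End gaussian_operator.

(** * Law of a Gaussian linear combination on a cylinder event *)

Lemma mulVKe_EFin (R : realType) (a : R) (x : \bar R) : a != 0 ->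
  (a^-1%:E * (a%:E * x) = x)%E.
Proof. by move=> a0; rewrite muleA -EFinM mulVf// mul1e. Qed.

Section law.
Context d (Omega : measurableType d) (R : realType) (P : probability Omega R).
Variables (I : finType) (X : I -> {RV P >-> R}).
Hypothesis indep : mutually_independent X.
Local Notation gam := (@std_normal R).
Local Notation vec := (R * R * (R * R))%type.
Local Notation indic C := (fun z : vec => (\1_C z)%:E : \bar R).

Definition cylinder (B : I -> set R) : set Omega :=
  \bigcap_(i in [set: I]) (X i @^-1` B i).

Definition lincomb (y : I -> vec) (J : seq I) (w : Omega) : vec :=
  \sum_(j <- J) X j w *: y j.

Lemma gauss_ops_translate ys (H : vec -> \bar R) (v z : vec) :
  gauss_ops ys (fun u => H (u + v)) z = gauss_ops ys H (z + v).
Proof.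
elim: ys z => // y ys IH z; rewrite !gauss_ops_cons /gauss_op.
by apply: eq_integral => x _; rewrite IH addrAC.
Qed.

Lemma measurable_lincomb y J : measurable_fun setT (lincomb y J).
Proof.
elim: J => [|j J IH].
  by rewrite (_ : lincomb y [::] = cst 0)//; apply/funext => w; rewrite /lincomb big_nil.
rewrite (_ : lincomb y (j :: J) = fun w => lincomb y J w + X j w *: y j).
  exact: measurable_vec_comb.
by apply/funext => w; rewrite /lincomb big_cons addrC.
Qed.

HB.instance Definition _ y J :=
  isMeasurableFun.Build _ _ _ _ (lincomb y J) (measurable_lincomb y J).

Lemma measurable_cylinder B : (forall i, measurable (B i)) -> measurable (cylinder B).
Proof.
move=> mB; apply: fin_bigcap_measurable => // i _.
by rewrite -[_ @^-1` _]setTI; exact: measurable_funP.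
Qed.

Lemma cylinder_update B j A : B j = setT ->
  cylinder (fun i => if i == j then A else B i) = cylinder B `&` (X j @^-1` A).
Proof.
move=> Bj; apply/seteqP; split => [w Cw|w [Cw Xw] i _ /=].
  split; last by have /= := Cw j Logic.I; rewrite eqxx.
  move=> i _ /=; have /= := Cw i Logic.I; case: eqP => // ->.
  by rewrite Bj.
by case: eqP => [->//|_]; exact: Cw.
Qed.

Lemma cylinder_update_prob B j A : (forall i, measurable (B i)) -> B j = setT ->
  measurable A -> P (cylinder B `&` (X j @^-1` A)) = (P (X j @^-1` A) * P (cylinder B))%E.
Proof.
move=> mB Bj mA; rewrite -cylinder_update// /cylinder !indep//; last first.
  by move=> i; case: ifP.
rewrite (bigD1 j)//= eqxx [in RHS](bigD1 j)//= Bj preimage_setT probability_setT mul1e.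
by congr (_ * _)%E; apply: eq_bigr => i /negbTE ->.
Qed.

(* A cylinder leaving the coordinates in [J] free is independent of the linear
   combination over [J]; this form is what makes the induction on [J] work. *)
Lemma lincomb_law (y : I -> vec) (J : seq I) (B : I -> set R) (C : set vec) :
  uniq J -> (forall j, j \in J -> std_gaussian (X j)) ->
  (forall i, measurable (B i)) -> (forall j, j \in J -> B j = setT) ->
  measurable C ->
  P (cylinder B `&` (lincomb y J @^-1` C)) =
  (P (cylinder B) * gauss_ops (map y J) (indic C) 0%R)%E.
Proof.
elim: J B C => [|j J IH] B C.
  move=> _ _ mB _ mC /=.
  have -> : lincomb y [::] = cst 0 by apply/funext => w; rewrite /lincomb big_nil.
  rewrite preimage_cst indicE; case: ifPn => C0; first by rewrite setIT mule1.
  by rewrite setI0 measure0 mule0.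
rewrite cons_uniq => /andP[jJ uJ] gJ mB BJ mC.
have gJ' i : i \in J -> std_gaussian (X i) by move=> iJ; apply: gJ; rewrite inE iJ orbT.
have BJ' i : i \in J -> B i = setT by move=> iJ; apply: BJ; rewrite inE iJ orbT.
have Bj : B j = setT by apply: BJ; rewrite mem_head.
have mE := measurable_cylinder mB.
(* A null cylinder is treated apart, because the argument below divides by its probability. *)
have [PE0|PE0] := eqVneq (P (cylinder B)) 0%E.
  rewrite PE0 mul0e; apply/eqP; rewrite eq_le measure_ge0 andbT -PE0.
  apply: le_measure; rewrite ?inE//.
  apply: measurableI => //; rewrite -[_ @^-1` _]setTI; exact: measurable_lincomb.
pose p := fine (P (cylinder B)).
have pE : P (cylinder B) = p%:E by rewrite fineK// fin_num_measure.
have p0 : p != 0 by move: PE0; rewrite pE.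
have pge0 : 0 <= p by rewrite fine_ge0.
pose T w := (X j w, lincomb y J w).
have mT : measurable_fun setT T.
  by apply: measurable_fun_pair => //; exact: measurable_lincomb.
have pi0 : 0 <= p^-1 by rewrite invr_ge0.
pose m'0 : {measure set (R * vec) -> \bar R} :=
  mscale (NngNum pi0) (pushforward (mrestr P mE) T).
pose m' := m'0 mT.
pose nu : probability vec R := distribution P (lincomb y J).
have lawT A : measurable A -> nu A = gauss_ops (map y J) (indic A) 0.
  move=> mA; have := IH (fun=> setT) A uJ gJ' (fun=> measurableT) (fun _ _ => erefl) mA.
  rewrite (_ : cylinder _ = setT) ?setTI ?probability_setT ?mul1e//.
  by apply/seteqP; split.
(* [m'] is the conditional law of [(X j, lincomb y J)] given the cylinder. On a rectangle, the
   constraint [X j] in [A1] is absorbed into the cylinder before the induction hypothesis is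
   applied; agreement on rectangles then identifies [m'] with the product measure. *)
have cover A1 A2 : measurable A1 -> measurable A2 -> m' (A1 `*` A2) = (gam A1 * nu A2)%E.
  move=> mA1 mA2; rewrite lawT// /m' /m'0/= /mscale/= /pushforward /mrestr/=.
  have -> : T @^-1` (A1 `*` A2) `&` cylinder B =
      cylinder (fun i => if i == j then A1 else B i) `&` (lincomb y J @^-1` A2).
    rewrite cylinder_update// setIC -setIA; congr (_ `&` _).
  rewrite IH//; last 2 first.
  - by move=> i; case: ifP.
  - by move=> i iJ; case: eqP => [ij|_]; [move: jJ; rewrite -ij iJ|exact: BJ'].
  rewrite cylinder_update// cylinder_update_prob// pE (gJ _ (mem_head _ _))//.
  rewrite -std_normalE -[(gam A1 * _ * _)%E]muleA muleCA.
  by apply: mulVKe_EFin.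
pose Q : set (R * vec) := [set z | C (z.2 + z.1 *: y j)].
have mQ : measurable Q.
  rewrite -[Q]setTI; apply: (_ : measurable_fun setT (fun z : R * vec => z.2 + z.1 *: y j)) => //.
  exact: measurable_vec_comb.
have PQ : P (cylinder B `&` (lincomb y (j :: J) @^-1` C)) = (p%:E * m' Q)%E.
  rewrite /m' /m'0/= /mscale/= /pushforward /mrestr/= muleA -EFinM mulfV// mul1e setIC.
  congr (P (_ `&` _)); apply/seteqP; split => w /=;
    by rewrite /lincomb big_cons /Q/= addrC.
rewrite map_cons gauss_ops_cons PQ pE -(product_measure_unique cover mQ) /= /product_measure1.
congr (_ * _)%E; apply: eq_integral => x _ /=.
rewrite lawT; last exact: measurable_xsection.
rewrite -gauss_ops_translate; congr (gauss_ops _ _ _); apply/funext => u.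
rewrite !indicE /xsection/=; congr ((_ : bool)%:R%:E).
by apply/idP/idP; rewrite !inE/= !inE.
Qed.
End law.

(** * Probability of a wedge *)

(** Cauchy's functional equation with nonnegativity as the regularity assumption. Additivity gives
    [F (b / m) = 1 / m], and rounding [x] down to a multiple of [b / m] gives [x / b <= F x]. The
    reverse inequality is this one at [b - x], since [F x + F (b - x) = 1]. *)
Lemma nonneg_additive_linear (R : realType) (b : R) (F : R -> R) : 0 < b ->
  (forall x, 0 <= x <= b -> 0 <= F x) ->
  (forall x y, 0 <= x -> 0 <= y -> x + y <= b -> F (x + y) = F x + F y) ->
  F b = 1 -> forall x, 0 <= x <= b -> F x = x / b.
Proof.
move=> b0 F0 FD Fb.
have FM (t : R) (j : nat) : 0 <= t -> j%:R * t <= b -> F (j%:R * t) = j%:R * F t.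
  move=> t0; elim: j => [|j IH] jt.
    rewrite !mul0r; have := FD 0 0 (lexx _) (lexx _).
    by rewrite addr0 ltW// => /(_ isT) /eqP; rewrite -subr_eq subrr => /eqP.
  have jtS : j.+1%:R * t = j%:R * t + t by rewrite -natr1 mulrDl mul1r.
  rewrite jtS in jt *; rewrite FD// ?mulr_ge0//.
  by rewrite IH ?(le_trans _ jt) ?lerDl// -natr1 mulrDl mul1r.
have lower x : 0 <= x <= b -> x / b <= F x.
  move=> /andP[x0 xb]; apply/ler_addgt0Pr => e e0.
  pose m := (Num.truncn e^-1).+1.
  have m0 : 0 < m%:R :> R by rewrite ltr0n.
  have me : m%:R^-1 < e by rewrite -[ltRHS]invrK ltf_pV2 ?posrE ?invr_gt0// truncnS_gt.
  pose t := b / m%:R.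
  have t0 : 0 < t by rewrite divr_gt0.
  have mt : m%:R * t = b by rewrite mulrC divfK// gt_eqF.
  have Ft : F t = m%:R^-1.
    have := FM t m (ltW t0); rewrite mt lexx Fb => /(_ isT) mF.
    by apply: (mulfI (lt0r_neq0 m0)); rewrite -mF mulfV// gt_eqF.
  pose j := Num.truncn (x / t).
  have xt0 : 0 <= x / t by rewrite divr_ge0// ltW.
  have /andP[jx xj] := truncn_itv xt0; rewrite -/j in jx xj.
  have jtx : j%:R * t <= x by rewrite -ler_pdivlMr.
  have FX : j%:R / m%:R <= F x.
    have jt0 : 0 <= j%:R * t by rewrite mulr_ge0// ltW.
    have xE : x = j%:R * t + (x - j%:R * t) by rewrite addrC subrK.
    rewrite xE FD ?subr_ge0// -?xE// FM; [|exact: ltW|exact: le_trans xb].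
    rewrite Ft lerDl F0// subr_ge0 jtx/= (le_trans _ xb)// gerBl jt0//.
  have xjt : x / b < j.+1%:R / m%:R.
    move: xj; rewrite /t invf_div mulrA ltr_pdivrMr// => xj.
    by rewrite ltr_pdivrMr// mulrAC ltr_pdivlMr.
  by apply: (le_trans (ltW xjt)); rewrite -natr1 mulrDl mul1r lerD// ltW.
move=> x /andP[x0 xb]; apply/eqP; rewrite eq_le lower ?x0// andbT.
have bx : 0 <= b - x <= b by rewrite subr_ge0 xb gerBl.
have := lower _ bx; have := FD x (b - x) x0; rewrite subr_ge0 addrC subrK => /(_ xb (lexx _)).
rewrite Fb => FE; rewrite mulrBl mulfV ?gt_eqF// => h; lra.
Qed.

(** Along the directions [0], [x], [x + y] within a half-turn, the sign of a point off the axis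
    cannot change twice. This makes adjacent wedges disjoint and their union the whole wedge, up to
    a null set. *)
Lemma wedge_between (R : realType) (x y : R) (u : R * R) :
  0 <= x -> 0 <= y -> x + y <= pi -> u.1 != 0 ->
  (0 <= u.1) = (0 <= cos (x + y) * u.1 + sin (x + y) * u.2) ->
  (0 <= u.1) = (0 <= cos x * u.1 + sin x * u.2).
Proof.
move=> x0 y0 xy u0.
(* At [pi] the outer directions are opposite, so their signs differ off the axis; the
   convex-combination argument below needs [sin (x + y) > 0]. *)
have [->|xypi] := eqVneq (x + y) pi.
  by rewrite cospi sinpi mul0r addr0 mulN1r oppr_ge0; case: ltgtP u0.
have {}xypi : x + y < pi by rewrite lt_neqAle xypi.
have [->|xneq0] := eqVneq x 0; first by rewrite cos0 sin0 mul1r mul0r addr0.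
have xgt0 : 0 < x by rewrite lt_neqAle eq_sym xneq0.
have sxy : 0 < sin (x + y) by apply: sin_gt0_pi; rewrite xypi andbT ltr_pwDl.
have sx : 0 < sin x by apply: sin_gt0_pi; rewrite xgt0/= (le_lt_trans _ xypi)// lerDl.
have sy : 0 <= sin y by apply: sin_ge0_pi; rewrite y0/= (le_trans _ xy)// lerDr.
set q := cos (x + y) * _ + _; set p := cos x * _ + _.
(* The middle direction is a nonnegative combination of the two outer ones. *)
have E : sin (x + y) * p = sin y * u.1 + sin x * q.
  have c2 := cos2Dsin2 x.
  rewrite /p /q cosD sinD.
  transitivity (sin y * u.1 * (cos x ^+ 2 + sin x ^+ 2 - sin x ^+ 2) + sin x * cos x * cos y * u.1
    + sin x * (sin x * cos y + cos x * sin y) * u.2); first by ring.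
  by rewrite c2; ring.
have [u1|u1] := leP 0 u.1; have [q1|q1] := leP 0 q => // _; apply/esym.
  by rewrite -(pmulr_rge0 _ sxy) E addr_ge0// mulr_ge0// ltW.
apply/negbTE; rewrite -ltNge -(pmulr_rlt0 _ sxy) E.
by rewrite ltr_wnDl ?pmulr_rlt0// mulr_ge0_le0// ltW.
Qed.

Section wedge.
Context {R : realType}.
Local Notation gam := (@std_normal R).
Local Notation gam2 := (gam \x gam)%E.

Definition wedge (t : R) : set (R * R) :=
  [set u | sgn u.1 != sgn (cos t * u.1 + sin t * u.2)].

Lemma sgn_eqE (x y : R) : (sgn x == sgn y) = ((0 <= x) == (0 <= y)).
Proof.
have n : (1 == -1 :> R) = false by rewrite eq_sym eqNr oner_eq0.
by rewrite /sgn; do 2 case: ifP => _; rewrite ?eqxx ?n// eq_sym n.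
Qed.

Lemma measurable_lin2_0 (a b : R) :
  measurable_fun setT (fun z : R * R => a * z.1 + b * z.2).
Proof. by have := measurable_lin2 a b 0; under eq_fun do rewrite addr0. Qed.

Lemma measurable_lin2_ge0 (a b : R) :
  measurable [set u : R * R | 0 <= a * u.1 + b * u.2].
Proof.
rewrite (_ : [set _ | _] = setT `&` (fun z : R * R => a * z.1 + b * z.2) @^-1` `[0, +oo[%classic).
  exact: measurable_lin2_0.
by apply/seteqP; split => u /=; rewrite in_itv/= andbT ?setTI// => -[].
Qed.

Lemma measurable_wedge t : measurable (wedge t).
Proof.
pose A := [set u : R * R | 0 <= 1 * u.1 + 0 * u.2].
pose B := [set u : R * R | 0 <= cos t * u.1 + sin t * u.2].
rewrite (_ : wedge t = (A `\` B) `|` (B `\` A)).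
  by apply: measurableU; apply: measurableD; exact: measurable_lin2_ge0.
apply/seteqP; split => u; rewrite /wedge /A /B /= mul1r mul0r addr0 sgn_eqE.
  by case: (0 <= u.1); case: (0 <= _) => //= _; [left|right].
by case: (0 <= u.1); case: (0 <= _) => //= -[] [].
Qed.

Lemma gam2_indic (C : set (R * R)) : measurable C ->
  (\int[gam]_x \int[gam]_y (\1_C (x, y))%:E = gam2 C)%E.
Proof.
move=> mC.
have := fubini_tonelli1 (m1 := gam) (m2 := gam) (fun z => (\1_C z)%:E).
rewrite integral_indic// setIT => -> //.
exact/measurable_EFinP/measurable_indic.
Qed.

Lemma gam2_rotation (c s : R) (C : set (R * R)) : c ^+ 2 + s ^+ 2 = 1 ->
  measurable C ->
  gam2 [set u | C (c * u.1 - s * u.2, s * u.1 + c * u.2)] = gam2 C.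
Proof.
move=> cs mC.
have mR : measurable [set u | C (c * u.1 - s * u.2, s * u.1 + c * u.2)].
  rewrite -[X in measurable X]setTI.
  apply: (_ : measurable_fun setT (fun u : R * R => (c * u.1 - s * u.2, s * u.1 + c * u.2))) => //.
  apply: measurable_fun_pair; last exact: measurable_lin2_0.
  by have := measurable_lin2_0 c (- s); under eq_fun do rewrite mulNr.
have mI : measurable_fun setT (fun z : R * R => (\1_C z)%:E : \bar R).
  by apply/measurable_EFinP; exact: measurable_indic.
rewrite -(gam2_indic mR) -(gam2_indic mC).
by rewrite [RHS](normal_prob2_rotation cs mI)// => z; rewrite lee_fin.
Qed.

Lemma gam2_setT : gam2 setT = 1%E.
Proof.
rewrite -setXTT; have -> := product_measure1E gam gam (@measurableT _ R) (@measurableT _ R).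
rewrite -[RHS]mule1; congr (_ * _)%E; exact: (probability_setT gam).
Qed.

Lemma normal_prob_set1 (x : R) : gam [set x] = 0%E.
Proof. by rewrite [LHS]integral_set1. Qed.

Lemma gam2_axis0 : gam2 [set u | u.1 = 0] = 0%E.
Proof.
rewrite (_ : [set _ | _] = [set 0] `*` setT); last first.
  by apply/seteqP; split => [u /=|u []//].
have -> := product_measure1E gam gam (measurable_set1 (0 : R)) (@measurableT _ R).
by rewrite [X in (X * _)%E](normal_prob_set1 0) mul0e.
Qed.

Lemma measurable_lin2_eq0 (a b : R) : measurable [set u : R * R | a * u.1 + b * u.2 = 0].
Proof.
rewrite (_ : [set _ | _] = setT `&` (fun z : R * R => a * z.1 + b * z.2) @^-1` [set 0]).
  exact: measurable_lin2_0.
by apply/seteqP; split => u //= [].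
Qed.

Lemma measurable_axis0 : measurable [set u : R * R | u.1 = 0].
Proof. by have := measurable_lin2_eq0 1 0; under eq_fun do rewrite mul1r mul0r addr0. Qed.

Lemma gam2_line0 (a b : R) : a ^+ 2 + b ^+ 2 = 1 ->
  gam2 [set u | a * u.1 + b * u.2 = 0] = 0%E.
Proof.
move=> ab; rewrite -[RHS]gam2_axis0 -(@gam2_rotation a (- b) [set u | u.1 = 0]); last 2 first.
- by rewrite sqrrN.
- exact: measurable_axis0.
by congr (gam2 _); apply/seteqP; split => u /=; rewrite mulNr opprK.
Qed.

Lemma gam2_setD0 (A N : set (R * R)) : measurable A -> measurable N ->
  gam2 N = 0%E -> gam2 (A `\` N) = gam2 A.
Proof.
move=> mA mN N0.
rewrite [RHS](measureDI (gam \x gam)%E mA mN) /=.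
suff -> : (gam \x gam)%E (A `&` N) = 0%E by rewrite adde0.
exact: (subset_measure0 (measurableI _ _ mA mN) mN (@subIsetr _ _ _) N0).
Qed.

Lemma wedge_add (x y : R) : 0 <= x -> 0 <= y -> x + y <= pi ->
  gam2 (wedge (x + y)) = (gam2 (wedge x) + gam2 (wedge y))%E.
Proof.
move=> x0 y0 xy.
pose N : set (R * R) := [set u | u.1 = 0].
have mN := measurable_axis0.
have csx : cos x ^+ 2 + (- sin x) ^+ 2 = 1 by rewrite sqrrN cos2Dsin2.
(* [W] is [wedge y] turned by the angle [x]: the signs along the directions [x] and [x + y]
   differ. *)
pose W := [set u : R * R | wedge y (cos x * u.1 - - sin x * u.2, - sin x * u.1 + cos x * u.2)].
have mW : measurable W.
  rewrite -[W]setTI.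
  apply: (_ : measurable_fun setT (fun u : R * R => (cos x * u.1 - - sin x * u.2, - sin x * u.1 + cos x * u.2))) => //; last exact: measurable_wedge.
  apply: measurable_fun_pair; last exact: measurable_lin2_0.
  by have := measurable_lin2_0 (cos x) (sin x); under eq_fun do rewrite -[sin x]opprK mulNr.
rewrite -(gam2_rotation csx (measurable_wedge y)) -/W.
rewrite -(gam2_setD0 (measurable_wedge (x + y)) mN gam2_axis0).
rewrite -(gam2_setD0 (measurable_wedge x) mN gam2_axis0) -(gam2_setD0 mW mN gam2_axis0).
have WE u : W u <-> sgn (cos x * u.1 + sin x * u.2) !=
    sgn (cos (x + y) * u.1 + sin (x + y) * u.2).
  rewrite /W /wedge /= cosD sinD.
  have -> : cos x * u.1 - - sin x * u.2 = cos x * u.1 + sin x * u.2 by ring.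
  by have -> : cos y * (cos x * u.1 + sin x * u.2) + sin y * (- sin x * u.1 + cos x * u.2)
    = (cos x * cos y - sin x * sin y) * u.1 + (sin x * cos y + cos x * sin y) * u.2 by ring.
have key u : u.1 != 0 ->
    (0 <= u.1) = (0 <= cos (x + y) * u.1 + sin (x + y) * u.2) ->
    (0 <= u.1) = (0 <= cos x * u.1 + sin x * u.2) by exact: wedge_between.
have -> : wedge (x + y) `\` N = (wedge x `\` N) `|` (W `\` N).
  apply/seteqP; split => u /=; rewrite /wedge/= WE !sgn_eqE /N/=.
    move=> [H /eqP u0]; have := key u u0; move: H.
    by case: (0 <= u.1); case: (0 <= _ + _); case: (0 <= _ + _) => //= _ _;
      (try by left; split => //; apply/eqP); right; split => //; apply/eqP.
  case=> -[H /eqP u0]; have := key u u0; move: H;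
    by case: (0 <= u.1); case: (0 <= _ + _); case: (0 <= _ + _) => //= _ h;
     (split; [|by apply/eqP]) => //; have := h erefl.
rewrite measureU//; try by apply: measurableD => //; exact: measurable_wedge.
apply/seteqP; split => // u [[]]; rewrite /wedge/= sgn_eqE => H /eqP u0 [/WE].
rewrite sgn_eqE; have := key u u0; move: H.
by case: (0 <= u.1); case: (0 <= _ + _); case: (0 <= _ + _) => //= _ h; have := h erefl.
Qed.

Lemma gam2_wedge (t : R) : 0 <= t <= pi -> gam2 (wedge t) = (t / pi)%:E.
Proof.
move=> t0pi.
have le1 A : measurable A -> (0 <= gam2 A <= 1)%E.
  move=> mA; rewrite measure_ge0/= -gam2_setT; apply: le_measure; rewrite ?inE//.
have fin x : gam2 (wedge x) \is a fin_num.
  have /andP[g0 g1] := le1 _ (measurable_wedge x).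
  by rewrite ge0_fin_numE// (le_lt_trans g1) ?ltry.
pose F x := fine (gam2 (wedge x)).
rewrite -[LHS]fineK//; congr EFin.
rewrite -[LHS]/(F t); apply: nonneg_additive_linear => //; first exact: pi_gt0.
- by move=> x _; rewrite /F fine_ge0// measure_ge0.
- by move=> x y x0 y0 xy; rewrite /F wedge_add// fineD.
(* The normalisation: at angle [pi] every point off the axis is a mismatch. *)
rewrite /F -(gam2_setD0 (measurable_wedge pi) measurable_axis0 gam2_axis0).
have -> : wedge pi `\` [set u | u.1 = 0] = setT `\` [set u | u.1 = 0].
  apply/seteqP; split => u /= [_ /eqP u0]; split => //; try exact/eqP.
  rewrite /wedge/= sinpi cospi mul0r addr0 mulN1r sgn_eqE oppr_ge0.
  by case: ltgtP u0.
by rewrite gam2_setD0 ?gam2_setT//; [exact: measurable_axis0|exact: gam2_axis0].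
Qed.

End wedge.

(** * Covariance of two mismatch events *)

Section gaussian_plane.
Context {R : realType}.
Local Notation mu := (@lebesgue_measure R).
Local Notation phi := (@normal_pdf R 0 1).
Local Notation gam := (@std_normal R).

Lemma std_normal_pdf2E (x y : R) :
  phi x * phi y = normal_peak 1 ^+ 2 * expR (- ((x ^+ 2 + y ^+ 2) / 2)).
Proof.
by rewrite !std_normal_pdfE mulrACA -expr2 -expRD -opprD -mulrDl.
Qed.

Lemma measurable_lin22 (K : R * R -> \bar R) (a b c a' b' c' : R) :
  measurable_fun setT K ->
  measurable_fun setT
    (fun z : R * R => K (a * z.1 + b * z.2 + c, a' * z.1 + b' * z.2 + c')).
Proof.
move=> mK; apply: (measurableT_comp mK); apply: measurable_fun_pair;
  exact: measurable_lin2.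
Qed.

Definition leb2 (K : R * R -> \bar R) : \bar R := (\int[mu]_x \int[mu]_y K (x, y))%E.
Definition gauss2 (K : R * R -> \bar R) : \bar R := (\int[gam]_x \int[gam]_y K (x, y))%E.

Lemma measurable_leb_inner (L : R * R -> \bar R) : measurable_fun setT L ->
  (forall z, 0 <= L z)%E -> measurable_fun setT (fun u => \int[mu]_v L (u, v))%E.
Proof. by move=> mL L0; exact: (measurable_fun_fubini_tonelli_F (m2 := mu) L). Qed.

(** A triangular substitution done one variable at a time: at a fixed outer variable the shear [t]
    is a mere translation of the inner one. *)
Lemma leb2_affine (a1 a2 b1 : R) (t : R -> R) (L : R * R -> \bar R) :
  a1 != 0 -> a2 != 0 -> measurable_fun setT L -> (forall z, 0 <= L z)%E ->
  leb2 (fun z => L (a1 * z.1 + b1, a2 * z.2 + t z.1)) =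
  (`|a1^-1 * a2^-1|%:E * leb2 L)%E.
Proof.
move=> a10 a20 mL L0; rewrite /leb2 /=.
have mG := measurable_leb_inner mL L0.
have G0 u : (0 <= \int[mu]_v L (u, v))%E by exact: integral_ge0.
transitivity (\int[mu]_x (`|a2^-1|%:E * \int[mu]_v L (a1 * x + b1, v)%R))%E.
  apply: eq_integral => x _.
  apply: (@ge0_integral_affineV _ a2 (t x) (fun v => L (a1 * x + b1, v))) => //.
  exact: measurable_fun_section.
rewrite normrM mulrC EFinM -muleA ge0_integralZl//; last first.
  by apply: (measurableT_comp mG); exact: measurable_affine.
congr (_ * _)%E.
exact: (@ge0_integral_affineV _ a1 b1 (fun u => \int[mu]_v L (u, v))%E).
Qed.

Lemma leb2Zl (k : R) (L : R * R -> \bar R) : 0 <= k ->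
  measurable_fun setT L -> (forall z, 0 <= L z)%E ->
  (k%:E * leb2 L = leb2 (fun z => k%:E * L z))%E.
Proof.
move=> k0 mL L0; rewrite /leb2 /=.
have mG := measurable_leb_inner mL L0.
have G0 u : (0 <= \int[mu]_v L (u, v))%E by exact: integral_ge0.
rewrite -ge0_integralZl//; apply: eq_integral => x _.
by rewrite ge0_integralZl//; exact: measurable_fun_section.
Qed.

Lemma leb2D (K L : R * R -> \bar R) :
  measurable_fun setT K -> (forall z, 0 <= K z)%E ->
  measurable_fun setT L -> (forall z, 0 <= L z)%E ->
  (leb2 K + leb2 L = leb2 (fun z => K z + L z))%E.
Proof.
move=> mK K0 mL L0; rewrite /leb2 /=.
rewrite -ge0_integralD//; last 4 first.
- by move=> x _; exact: integral_ge0.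
- exact: measurable_leb_inner.
- by move=> x _; exact: integral_ge0.
- exact: measurable_leb_inner.
by apply: eq_integral => x _; rewrite ge0_integralD//; exact: measurable_fun_section.
Qed.

Lemma le_leb2 (K L : R * R -> \bar R) :
  measurable_fun setT K -> (forall z, 0 <= K z)%E ->
  measurable_fun setT L -> (forall z, K z <= L z)%E -> (leb2 K <= leb2 L)%E.
Proof.
move=> mK K0 mL KL; have L0 z : (0 <= L z)%E := le_trans (K0 z) (KL z).
apply: ge0_le_integral => //.
- by move=> x _; exact: integral_ge0.
- exact: measurable_leb_inner.
- exact: measurable_leb_inner.
- by move=> x _; apply: ge0_le_integral => //; exact: measurable_fun_section.
Qed.

Lemma le_leb2_avg (e : R) (Q P1 P2 : R * R -> \bar R) : 0 <= e ->
  measurable_fun setT Q -> (forall z, 0 <= Q z)%E ->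
  measurable_fun setT P1 -> (forall z, 0 <= P1 z)%E ->
  measurable_fun setT P2 -> (forall z, 0 <= P2 z)%E ->
  (forall z, e%:E * Q z <= 2^-1%:E * P1 z + 2^-1%:E * P2 z)%E ->
  (e%:E * leb2 Q <= 2^-1%:E * leb2 P1 + 2^-1%:E * leb2 P2)%E.
Proof.
move=> e0 mQ Q0 m1 p1 m2 p2 QP.
have half0 : 0 <= 2^-1 :> R by rewrite invr_ge0.
have mZ (k : R) L : measurable_fun setT L -> measurable_fun setT (fun z : R * R => k%:E * L z)%E.
  by move=> mL; exact: emeasurable_funM.
have Z0 (k : R) (L : R * R -> \bar R) z : 0 <= k -> (0 <= L z)%E -> (0 <= k%:E * L z)%E.
  by move=> k0 Lz; rewrite mule_ge0.
rewrite !leb2Zl// leb2D//; [|exact: mZ|by move=> z; exact: Z0|exact: mZ|by move=> z; exact: Z0].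
apply: le_leb2 => //; first exact: mZ.
- by move=> z; exact: Z0.
- by apply: emeasurable_funD; exact: mZ.
Qed.

Lemma eq_leb2 (K L : R * R -> \bar R) : K =1 L -> leb2 K = leb2 L.
Proof. by move=> /funext ->. Qed.

Lemma gauss2E (K : R * R -> \bar R) :
  measurable_fun setT K -> (forall x, 0 <= K x)%E ->
  gauss2 K = leb2 (fun z => K z * (phi z.1 * phi z.2)%:E)%E.
Proof. exact: ge0_integral2_normal_prob. Qed.

Lemma gauss2_rotation (c s : R) (K : R * R -> \bar R) :
  c ^+ 2 + s ^+ 2 = 1 -> measurable_fun setT K -> (forall x, 0 <= K x)%E ->
  gauss2 K = gauss2 (fun z => K (c * z.1 - s * z.2, s * z.1 + c * z.2)).
Proof. exact: normal_prob2_rotation. Qed.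

Lemma measurable_phi2 (f g : R * R -> R) :
  measurable_fun setT f -> measurable_fun setT g ->
  measurable_fun setT (fun z => (phi (f z) * phi (g z))%:E).
Proof.
move=> mf mg; apply/measurable_EFinP; apply: measurable_funM;
  exact: (measurableT_comp (measurable_normal_pdf 0 1)).
Qed.

Lemma phi2_ge0 (x y : R) : (0 <= (phi x * phi y)%:E)%E.
Proof. by rewrite lee_fin mulr_ge0 ?normal_pdf_ge0. Qed.

(** For the lower triangular matrix [B] and a standard planar Gaussian [Z], the density of [B Z] at
    [w] is the standard one at [B^-1 w] divided by [det B]. Since [B] is a contraction,
    [|B^-1 w| >= |w|], so [det B] times this density is at most the standard density at [w]. *)
Lemma gauss2_contract (b11 b21 b22 : R) (F : R * R -> \bar R) :
  0 < b11 -> 0 < b22 ->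
  (forall x y, (b11 * x) ^+ 2 + (b21 * x + b22 * y) ^+ 2 <= x ^+ 2 + y ^+ 2) ->
  measurable_fun setT F -> (forall x, 0 <= F x)%E ->
  ((b11 * b22)%:E * gauss2 (fun z => F (b11 * z.1, b21 * z.1 + b22 * z.2)%R)
    <= gauss2 F)%E.
Proof.
move=> b1 b2 bB mF F0.
have n1 : b11 != 0 by rewrite gt_eqF.
have n2 : b22 != 0 by rewrite gt_eqF.
pose f (z : R * R) := b11^-1 * z.1.
pose g (z : R * R) := b22^-1 * (z.2 - b21 / b11 * z.1).
have mf : measurable_fun setT f by exact: measurable_funM.
have mg : measurable_fun setT g.
  apply: measurable_funM => //; apply: measurable_funB => //; exact: measurable_funM.
have mL := emeasurable_funM mF (measurable_phi2 mf mg).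
have L0 z : (0 <= F z * (phi (f z) * phi (g z))%:E)%E by rewrite mule_ge0// phi2_ge0.
have mB : measurable_fun setT (fun z : R * R => F (b11 * z.1, b21 * z.1 + b22 * z.2)).
  have := measurable_lin22 b11 0 0 b21 b22 0 mF.
  by under eq_fun do rewrite !addr0 mul0r addr0.
rewrite (gauss2E mB (fun=> F0 _)) (gauss2E mF F0).
rewrite (_ : leb2 _ = (`|b11^-1 * b22^-1|%:E * leb2 (fun z => F z * (phi (f z) * phi (g z))%:E))%E).
  rewrite muleA -EFinM gtr0_norm ?mulr_gt0 ?invr_gt0// mulrACA !mulfV// mulr1 mul1e.
  apply: le_leb2 => //; first exact: emeasurable_funM (measurable_phi2 _ _).
  move=> [u v]; rewrite lee_wpmul2l// lee_fin /f /g /= !std_normal_pdf2E.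
  rewrite ler_wpM2l ?sqr_ge0// ler_expR lerN2 ler_pM2r ?invr_gt0//.
  have := bB (b11^-1 * u) (b22^-1 * (v - b21 / b11 * u)).
  rewrite !mulVKf//.
  by have -> : b21 * (b11^-1 * u) + (v - b21 / b11 * u) = v by ring.
rewrite -(leb2_affine 0 (fun x => b21 * x) n1 n2 mL L0); apply: eq_leb2 => -[x y].
rewrite /f /g /= addr0 [b22 * y + _]addrC.
congr (_ * (phi _ * phi _)%:E)%E; first by rewrite mulKf.
by field; rewrite n1 n2.
Qed.

Lemma gauss2_shift (m1 m2 : R) (F : R * R -> \bar R) :
  measurable_fun setT F -> (forall x, 0 <= F x)%E ->
  gauss2 (fun z => F (m1 + z.1, m2 + z.2)) =
  leb2 (fun z => F z * (phi (z.1 - m1)%R * phi (z.2 - m2)%R)%:E)%E.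
Proof.
move=> mF F0.
have mB : measurable_fun setT (fun z : R * R => F (m1 + z.1, m2 + z.2)).
  have := measurable_lin22 1 0 m1 0 1 m2 mF.
  by under eq_fun do rewrite !mul1r !mul0r add0r addr0 addrC [X in (_, X)]addrC.
rewrite (gauss2E mB (fun=> F0 _)).
have m1' : measurable_fun setT (fun z : R * R => z.1 - m1) by exact: measurable_funB.
have m2' : measurable_fun setT (fun z : R * R => z.2 - m2) by exact: measurable_funB.
have mL := emeasurable_funM mF (measurable_phi2 m1' m2').
have L0 z : (0 <= F z * (phi (z.1 - m1)%R * phi (z.2 - m2)%R)%:E)%E by rewrite mule_ge0// phi2_ge0.
have n1 := oner_neq0 R.
transitivity (`|1^-1 * 1^-1|%:E * leb2 (fun z => F z * (phi (z.1 - m1) * phi (z.2 - m2))%:E))%E; last first.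
  by rewrite invr1 mul1r normr1 mul1e.
rewrite -(leb2_affine m1 (fun=> m2) n1 n1 mL L0); apply: eq_leb2 => -[x y].
by rewrite /= !mul1r !addrK [x + _]addrC [y + _]addrC.
Qed.

(** For even [F] the shifts by [m] and [-m] have the same expectation, so the shifted density may be
    replaced by the average of the two. This cancels the term linear in [m] and leaves a loss
    quadratic in [m]. *)
Lemma gauss2_shift_even (m1 m2 : R) (F : R * R -> \bar R) :
  measurable_fun setT F -> (forall x, 0 <= F x)%E ->
  (forall x y, F (- x, - y) = F (x, y)) ->
  ((expR (- ((m1 ^+ 2 + m2 ^+ 2) / 2)))%:E * gauss2 F
   <= gauss2 (fun z => F (m1 + z.1, m2 + z.2)%R))%E.
Proof.
move=> mF F0 Fe.
set e := expR _.
have mB : measurable_fun setT (fun z : R * R => F (m1 + z.1, m2 + z.2)).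
  have := measurable_lin22 1 0 m1 0 1 m2 mF.
  by under eq_fun do rewrite !mul1r !mul0r add0r addr0 addrC [X in (_, X)]addrC.
have sym : gauss2 (fun z => F (m1 + z.1, m2 + z.2)) =
           gauss2 (fun z => F (- m1 + z.1, - m2 + z.2)).
  have cs : (-1) ^+ 2 + 0 ^+ 2 = 1 :> R by rewrite sqrrN expr1n expr0n addr0.
  rewrite (gauss2_rotation cs mB (fun=> F0 _)); congr gauss2; apply/funext => -[x y] /=.
  by rewrite -Fe; congr (F (_, _)); ring.
have half_sum (A : \bar R) : (0 <= A)%E -> (A = 2^-1%:E * A + 2^-1%:E * A)%E.
  by move=> A0; rewrite -ge0_muleDl ?lee_fin// -EFinD -mulr2n -[2^-1 *+ 2]mulr_natr mulVf ?mul1e.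
rewrite (_ : gauss2 (fun z => F (m1 + z.1, m2 + z.2)) =
  (2^-1%:E * gauss2 (fun z => F (m1 + z.1, m2 + z.2)%R) + 2^-1%:E * gauss2 (fun z => F (- m1 + z.1, - m2 + z.2)%R))%E); last first.
  rewrite -sym; apply: half_sum; apply: integral_ge0 => x _; exact: integral_ge0.
rewrite (gauss2_shift m1 m2 mF F0) (gauss2_shift (- m1) (- m2) mF F0) (gauss2E mF F0).
have half0 : 0 <= 2^-1 :> R by rewrite invr_ge0.
have e0 : 0 <= e by exact: expR_ge0.
have mP a b : measurable_fun setT (fun z : R * R => F z * (phi (z.1 - a) * phi (z.2 - b))%:E)%E.
  by apply: emeasurable_funM => //; apply: measurable_phi2; exact: measurable_funB.
have P0 a b z : (0 <= F z * (phi (z.1 - a) * phi (z.2 - b))%:E)%E by rewrite mule_ge0// phi2_ge0.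
have mQ : measurable_fun setT (fun z : R * R => F z * (phi z.1 * phi z.2)%:E)%E.
  by apply: emeasurable_funM => //; exact: measurable_phi2.
have Q0 z : (0 <= F z * (phi z.1 * phi z.2)%:E)%E by rewrite mule_ge0// phi2_ge0.
apply: le_leb2_avg => //.
move=> [x y]; rewrite /= !(muleCA _ (F _)) -ge0_muleDr ?mule_ge0 ?phi2_ge0 ?lee_fin//.
rewrite lee_wpmul2l// -!EFinM -EFinD lee_fin !std_normal_pdf2E !opprK.
rewrite !(mulrCA _ (normal_peak 1 ^+ 2)) -mulrDr ler_wpM2l ?sqr_ge0//.
rewrite /e -expRD.
(* AM-GM: the geometric mean of the two shifted densities is [e] times the
   centred one. *)
set p := expR (- (((x - m1) ^+ 2 + (y - m2) ^+ 2) / 4)).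
set q := expR (- (((x + m1) ^+ 2 + (y + m2) ^+ 2) / 4)).
have -> : expR (- ((m1 ^+ 2 + m2 ^+ 2) / 2) + - ((x ^+ 2 + y ^+ 2) / 2)) = p * q.
  by rewrite /p /q -expRD; congr expR; field.
have -> : expR (- (((x - m1) ^+ 2 + (y - m2) ^+ 2) / 2)) = p ^+ 2.
  by rewrite [RHS]expr2 /p -expRD; congr expR; field.
have -> : expR (- (((x + m1) ^+ 2 + (y + m2) ^+ 2) / 2)) = q ^+ 2.
  by rewrite [RHS]expr2 /q -expRD; congr expR; field.
have := sqr_ge0 (p - q); lra.
Qed.

End gaussian_plane.

Lemma contraction_det_le1 (R : realFieldType) (a b c : R) :
  (forall x y, (a * x) ^+ 2 + (b * x + c * y) ^+ 2 <= x ^+ 2 + y ^+ 2) -> a * c <= 1.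
Proof.
move=> h; have h1 := h 1 0; have h2 := h 0 1; clear h.
have := sqr_ge0 b; have := sqr_ge0 (a - c); nra.
Qed.

(** Here [b] is [det B], [t] is [|m|^2 / 2], [e] is [exp (- t)], and [g], [x], [y] are the Gaussian
    measures of [C], of its translate, and of the preimage of that translate under [B]. The
    comparison lemmas bound measures in one direction only, so the shift bound is applied to the
    complement of [C]. *)
Lemma affine_even_arith (R : realFieldType) (b x y g t e : R) : e <= 1 ->
  b * y <= x -> g <= 1 -> y <= 1 -> b <= 1 -> 1 - t <= e ->
  e * (1 - g) <= 1 - x -> 0 <= g -> y <= g + (1 - b) + t.
Proof.
move=> e1 h1 g1 y1 b1 te h2 g0.
have : (1 - b) * y <= 1 - b by rewrite ler_piMr// subr_ge0.
have : (1 - e) * (1 - g) <= 1 - e by rewrite ler_piMr ?subr_ge0// gerBl.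
lra.
Qed.

Section cholesky_arith.
Variables (R : realFieldType) (m11 m12 m21 m22 b11 b21 b22 : R).
(** The three hypotheses are the entries of [M^T M + B B^T = I], with [B] lower triangular. They
    yield [B B^T <= I] at once, while the density comparison needs [B^T B <= I]. *)
Hypothesis h33 : m11 ^+ 2 + m21 ^+ 2 + b11 ^+ 2 = 1.
Hypothesis h44 : m12 ^+ 2 + m22 ^+ 2 + (b21 ^+ 2 + b22 ^+ 2) = 1.
Hypothesis h34 : m11 * m12 + m21 * m22 + b11 * b21 = 0.

Lemma cholesky_contraction x y :
  (b11 * x) ^+ 2 + (b21 * x + b22 * y) ^+ 2 <= x ^+ 2 + y ^+ 2.
Proof.
(* [A D - B^2] is [det (I - L^T L) = det (M^T M)], where [L L^T = I - M^T M] is the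
   Cholesky factorisation with entries [b11], [b21], [b22]. *)
pose A := 1 - b11 ^+ 2 - b21 ^+ 2; pose D := 1 - b22 ^+ 2; pose B := b21 * b22.
have AD : 0 <= A * D - B ^+ 2.
  have -> : A * D - B ^+ 2 = (m11 * m22 - m12 * m21) ^+ 2 + ((m11 * m12 + m21 * m22) ^+ 2 - (b11 * b21) ^+ 2).
    have b1 : b11 ^+ 2 = 1 - (m11 ^+ 2 + m21 ^+ 2) by rewrite -h33; ring.
    have b2 : b22 ^+ 2 = 1 - (m12 ^+ 2 + m22 ^+ 2) - b21 ^+ 2 by rewrite -h44; ring.
    rewrite /A /D /B !exprMn b1 b2; ring.
  have -> : m11 * m12 + m21 * m22 = - (b11 * b21) by apply/eqP; rewrite -addr_eq0 h34.
  by rewrite sqrrN subrr addr0 sqr_ge0.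
have D0 : 0 <= D.
  by rewrite /D -h44; have := (sqr_ge0 m12, sqr_ge0 m22, sqr_ge0 b21) => -[[]]; lra.
rewrite -subr_ge0.
have -> : x ^+ 2 + y ^+ 2 - ((b11 * x) ^+ 2 + (b21 * x + b22 * y) ^+ 2) =
  A * x ^+ 2 - B * x * y *+ 2 + D * y ^+ 2 by rewrite /A /B /D; ring.
(* Completing the square needs [D > 0]; if [D = 0] then [b21 = 0] and the cross term disappears. *)
move: D0; rewrite le_eqVlt => /predU1P[D0|D0].
  have m120 : m12 ^+ 2 + m22 ^+ 2 + b21 ^+ 2 = 0 by move: D0; rewrite /D -h44 => D0; lra.
  have b210 : b21 = 0.
    by apply/eqP; rewrite -sqrf_eq0; apply/eqP; have := (sqr_ge0 m12, sqr_ge0 m22, sqr_ge0 b21) => -[[]]; lra.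
  rewrite -D0 mul0r addr0 /B b210 !mul0r mul0rn subr0 mulr_ge0 ?sqr_ge0//.
  rewrite /A b210 expr0n subr0 -h33; have := (sqr_ge0 m11, sqr_ge0 m21) => -[]; lra.
rewrite -(pmulr_rge0 _ D0).
have -> : D * (A * x ^+ 2 - B * x * y *+ 2 + D * y ^+ 2) =
  (D * y - B * x) ^+ 2 + (A * D - B ^+ 2) * x ^+ 2 by ring.
by rewrite addr_ge0 ?sqr_ge0// mulr_ge0 ?sqr_ge0.
Qed.

(** With [0 <= det B <= 1], one has [det B >= (det B)^2 = det (I - M^T M) = 1 - |M|^2 + (det
    M)^2]. *)
Lemma cholesky_det : 0 <= b11 -> 0 <= b22 ->
  1 - b11 * b22 <= m11 ^+ 2 + m21 ^+ 2 + (m12 ^+ 2 + m22 ^+ 2).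
Proof.
move=> b1 b2; have p1 := contraction_det_le1 cholesky_contraction.
have p0 : 0 <= b11 * b22 by rewrite mulr_ge0.
have pp : (b11 * b22) ^+ 2 <= b11 * b22 by rewrite expr2 ler_piMl.
have E : (b11 * b22) ^+ 2 = 1 - (m11 ^+ 2 + m21 ^+ 2 + (m12 ^+ 2 + m22 ^+ 2)) + (m11 * m22 - m12 * m21) ^+ 2
  + ((m11 * m12 + m21 * m22) ^+ 2 - (b11 * b21) ^+ 2).
  have b11E : b11 ^+ 2 = 1 - (m11 ^+ 2 + m21 ^+ 2) by rewrite -h33; ring.
  have b22E : b22 ^+ 2 = 1 - (m12 ^+ 2 + m22 ^+ 2) - b21 ^+ 2 by rewrite -h44; ring.
  rewrite !exprMn b11E b22E; ring.
have kE : m11 * m12 + m21 * m22 = - (b11 * b21) by apply/eqP; rewrite -addr_eq0 h34.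
rewrite kE sqrrN subrr addr0 in E.
have := sqr_ge0 (m11 * m22 - m12 * m21); lra.
Qed.

Lemma cholesky_shift x y :
  (m11 * x + m21 * y) ^+ 2 + (m12 * x + m22 * y) ^+ 2 <=
  (m11 ^+ 2 + m21 ^+ 2 + (m12 ^+ 2 + m22 ^+ 2)) * (x ^+ 2 + y ^+ 2).
Proof.
rewrite -subr_ge0.
have -> : (m11 ^+ 2 + m21 ^+ 2 + (m12 ^+ 2 + m22 ^+ 2)) * (x ^+ 2 + y ^+ 2)
  - ((m11 * x + m21 * y) ^+ 2 + (m12 * x + m22 * y) ^+ 2) =
  (m11 * y - m21 * x) ^+ 2 + (m12 * y - m22 * x) ^+ 2 by ring.
by rewrite addr_ge0 ?sqr_ge0.
Qed.

End cholesky_arith.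

Section pair_bound.
Context {R : realType}.
Local Notation mu := (@lebesgue_measure R).
Local Notation phi := (@normal_pdf R 0 1).
Local Notation gam := (@std_normal R).
Local Notation gam2 := (gam \x gam)%E.
Local Notation vec := (R * R * (R * R))%type.
Local Notation indic C := (fun z => (\1_C z)%:E : \bar R).

Lemma measurable_indicE d (T : measurableType d) (C : set T) :
  measurable C -> measurable_fun setT (indic C).
Proof. by move=> mC; apply/measurable_EFinP; exact: measurable_indic. Qed.

Lemma indicE_ge0 T (C : set T) z : (0 <= (\1_C z : R)%:E)%E.
Proof. by rewrite lee_fin. Qed.

Lemma gauss2_indic (C : set (R * R)) : measurable C -> gauss2 (indic C) = gam2 C.
Proof. exact: gam2_indic. Qed.

Lemma measurable_gauss_inner (L : R * R -> \bar R) : measurable_fun setT L ->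
  (forall z, 0 <= L z)%E -> measurable_fun setT (fun u => \int[gam]_v L (u, v))%E.
Proof. by move=> mL L0; exact: (measurable_fun_fubini_tonelli_F (m2 := gam) L). Qed.

Lemma gauss2Zl (k : R) (L : R * R -> \bar R) : 0 <= k ->
  measurable_fun setT L -> (forall z, 0 <= L z)%E ->
  gauss2 (fun z => k%:E * L z)%E = (k%:E * gauss2 L)%E.
Proof.
move=> k0 mL L0; rewrite /gauss2 /=.
have mG := measurable_gauss_inner mL L0.
have G0 u : (0 <= \int[gam]_v L (u, v))%E by exact: integral_ge0.
rewrite -ge0_integralZl//; apply: eq_integral => x _.
by rewrite ge0_integralZl//; exact: measurable_fun_section.
Qed.

Lemma gauss2D (K L : R * R -> \bar R) :
  measurable_fun setT K -> (forall z, 0 <= K z)%E ->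
  measurable_fun setT L -> (forall z, 0 <= L z)%E ->
  gauss2 (fun z => K z + L z)%E = (gauss2 K + gauss2 L)%E.
Proof.
move=> mK K0 mL L0; rewrite /gauss2 /=.
rewrite -ge0_integralD//; last 4 first.
- by move=> x _; exact: integral_ge0.
- exact: measurable_gauss_inner.
- by move=> x _; exact: integral_ge0.
- exact: measurable_gauss_inner.
by apply: eq_integral => x _; rewrite ge0_integralD//; exact: measurable_fun_section.
Qed.

Lemma le_gauss2 (K L : R * R -> \bar R) :
  measurable_fun setT K -> (forall z, 0 <= K z)%E ->
  measurable_fun setT L -> (forall z, K z <= L z)%E -> (gauss2 K <= gauss2 L)%E.
Proof.
move=> mK K0 mL KL; have L0 z : (0 <= L z)%E := le_trans (K0 z) (KL z).
apply: ge0_le_integral => //.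
- by move=> x _; exact: integral_ge0.
- exact: measurable_gauss_inner.
- exact: measurable_gauss_inner.
- by move=> x _; apply: ge0_le_integral => //; exact: measurable_fun_section.
Qed.

(** The exact value is 1, but a crude constant suffices. From [x^2 / 4 <= exp (x^2 / 4)] one gets
    [x^2 phi(x) <= 4 phi(x / sqrt 2)], whose integral is [4 sqrt 2 <= 6]. *)
Lemma std_normal_second_moment : (\int[gam]_x (x ^+ 2)%:E <= 6%:E)%E.
Proof.
have mS : measurable_fun setT (fun x : R => (x ^+ 2)%:E).
  by apply/measurable_EFinP; exact: measurable_funX.
have S0 (x : R) : (0 <= (x ^+ 2)%:E)%E by rewrite lee_fin sqr_ge0.
rewrite ge0_integral_normal_prob//.
pose r : R := Num.sqrt 2.
have r2 : r ^+ 2 = 2 by rewrite sqr_sqrtr.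
have r0 : 0 < r by rewrite sqrtr_gt0.
have mp : measurable_fun setT (fun x : R => (phi x)%:E) by exact: measurable_std_normal_pdf.
have p0 (x : R) : (0 <= (phi x)%:E)%E by rewrite lee_fin normal_pdf_ge0.
have mq : measurable_fun setT (fun x : R => (phi (r^-1 * x + 0))%:E).
  by apply: measurable_std_normal_pdf; exact: measurable_affine.
apply: (@le_trans _ _ (\int[mu]_x (4%:E * (phi (r^-1 * x + 0)%R)%:E)))%E.
  apply: ge0_le_integral => //.
  - by move=> x _; rewrite mule_ge0.
  - exact: emeasurable_funM.
  - exact: emeasurable_funM.
  move=> x _; rewrite -!EFinM lee_fin addr0 !std_normal_pdfE mulrCA [leRHS]mulrCA.
  rewrite ler_wpM2l ?normal_peak_ge0// exprMn exprVn r2.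
  have -> : - (x ^+ 2 / 2) = - (2^-1 * x ^+ 2 / 2) - x ^+ 2 / 4 by field.
  rewrite expRD mulrCA [leRHS]mulrC ler_wpM2l ?expR_ge0//.
  rewrite expRN -ler_pdivlMr ?invr_gt0 ?expR_gt0// invrK.
  have := expR_ge1Dx (x ^+ 2 / 4); lra.
rewrite ge0_integralZl//.
have -> := @ge0_integral_affineV _ r^-1 0 (fun x => (phi x)%:E) (invr_neq0 (lt0r_neq0 r0)) mp p0.
rewrite integral_normal_pdf mule1 invrK gtr0_norm// -EFinM lee_fin.
have : r <= 3 / 2 by rewrite -ler_sqr ?nnegrE ?ltW// r2 expr_div_n; lra.
lra.
Qed.

Definition pgauss2 (C : set (R * R)) : R := fine (gam2 C).

Lemma gam2_le1 C : measurable C -> (gam2 C <= 1)%E.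
Proof. by move=> mC; rewrite -gam2_setT; apply: le_measure; rewrite ?inE. Qed.

Lemma gam2_pgauss2 C : measurable C -> gam2 C = (pgauss2 C)%:E.
Proof.
move=> mC; rewrite /pgauss2 fineK// ge0_fin_numE ?measure_ge0//.
by rewrite (le_lt_trans (gam2_le1 mC)) ?ltry.
Qed.

Lemma pgauss2_ge0 C : 0 <= pgauss2 C. Proof. by rewrite /pgauss2 fine_ge0// measure_ge0. Qed.

Lemma pgauss2_le1 C : measurable C -> pgauss2 C <= 1.
Proof. by move=> mC; rewrite -lee_fin -gam2_pgauss2// gam2_le1. Qed.

Lemma pgauss2_setC C : measurable C -> pgauss2 (~` C) = 1 - pgauss2 C.
Proof.
move=> mC; have mC' := measurableC mC.
have : gam2 (C `|` ~` C) = (gam2 C + gam2 (~` C))%E.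
  by rewrite measureU// setICr.
rewrite setUv gam2_setT !gam2_pgauss2// -EFinD => -[->].
by rewrite addrC addKr.
Qed.

Lemma measurable_lin_set (C : set (R * R)) (a b c a' b' c' : R) : measurable C ->
  measurable [set u : R * R | C (a * u.1 + b * u.2 + c, a' * u.1 + b' * u.2 + c')].
Proof.
move=> mC; rewrite -[X in measurable X]setTI.
apply: (_ : measurable_fun setT (fun u : R * R =>
  (a * u.1 + b * u.2 + c, a' * u.1 + b' * u.2 + c'))) => //.
by apply: measurable_fun_pair; exact: measurable_lin2.
Qed.

Lemma pgauss2_contract (C : set (R * R)) (b11 b21 b22 : R) : measurable C ->
  0 <= b11 -> 0 <= b22 ->
  (forall x y, (b11 * x) ^+ 2 + (b21 * x + b22 * y) ^+ 2 <= x ^+ 2 + y ^+ 2) ->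
  b11 * b22 * pgauss2 [set u | C (b11 * u.1, b21 * u.1 + b22 * u.2)] <= pgauss2 C.
Proof.
(* A singular matrix makes the left-hand side zero, so the density comparison is only invoked for
   positive diagonal entries. *)
move=> mC; rewrite le_eqVlt => /predU1P[<-|b1].
  by rewrite !mul0r => _ _; exact: pgauss2_ge0.
rewrite le_eqVlt => /predU1P[<-|b2 bB]; first by rewrite mulr0 mul0r => _; exact: pgauss2_ge0.
have mD : measurable [set u : R * R | C (b11 * u.1, b21 * u.1 + b22 * u.2)].
  have := @measurable_lin_set C b11 0 0 b21 b22 0 mC.
  by under eq_set do rewrite !addr0 mul0r addr0.
have := gauss2_contract b1 b2 bB (measurable_indicE mC) (indicE_ge0 _).
have -> : gauss2 (fun z => (\1_C (b11 * z.1, b21 * z.1 + b22 * z.2))%:E) =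
  gam2 [set u : R * R | C (b11 * u.1, b21 * u.1 + b22 * u.2)] := gauss2_indic mD.
by rewrite (gauss2_indic mC) !gam2_pgauss2// -EFinM lee_fin.
Qed.

Lemma pgauss2_shift_even (C : set (R * R)) (m1 m2 : R) : measurable C ->
  (forall x y, C (- x, - y) <-> C (x, y)) ->
  expR (- ((m1 ^+ 2 + m2 ^+ 2) / 2)) * pgauss2 C <= pgauss2 [set u | C (m1 + u.1, m2 + u.2)].
Proof.
move=> mC Ce.
pose D := [set u : R * R | C (m1 + u.1, m2 + u.2)].
have mD : measurable D.
  have := @measurable_lin_set C 1 0 m1 0 1 m2 mC.
  by under eq_set do rewrite !mul1r !mul0r add0r addr0 addrC [X in (_, X)]addrC.
have := @gauss2_shift_even _ m1 m2 (indic C) (measurable_indicE mC) (indicE_ge0 _).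
have -> : gauss2 (fun z => (\1_C (m1 + z.1, m2 + z.2))%:E) = gam2 D := gauss2_indic mD.
rewrite (gauss2_indic mC) !gam2_pgauss2// -EFinM lee_fin; apply.
by move=> x y; rewrite !indicE; congr ((_ : bool)%:R%:E); apply/idP/idP; rewrite !inE => /Ce.
Qed.

Lemma pgauss2_affine_even (C : set (R * R)) (m1 m2 b11 b21 b22 : R) : measurable C ->
  (forall x y, C (- x, - y) <-> C (x, y)) -> 0 <= b11 -> 0 <= b22 ->
  (forall x y, (b11 * x) ^+ 2 + (b21 * x + b22 * y) ^+ 2 <= x ^+ 2 + y ^+ 2) ->
  pgauss2 [set u | C (m1 + b11 * u.1, m2 + (b21 * u.1 + b22 * u.2))] <=
  pgauss2 C + (1 - b11 * b22) + (m1 ^+ 2 + m2 ^+ 2) / 2.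
Proof.
move=> mC Ce b1 b2 bB.
pose D := [set u : R * R | C (m1 + u.1, m2 + u.2)].
have mD : measurable D.
  have := @measurable_lin_set C 1 0 m1 0 1 m2 mC.
  by under eq_set do rewrite !mul1r !mul0r add0r addr0 addrC [X in (_, X)]addrC.
have mE : measurable [set u : R * R | D (b11 * u.1, b21 * u.1 + b22 * u.2)].
  have := @measurable_lin_set D b11 0 0 b21 b22 0 mD.
  by under eq_set do rewrite !addr0 mul0r addr0.
have h1 := pgauss2_contract mD b1 b2 bB.
have Cc x y : (~` C) (- x, - y) <-> (~` C) (x, y) by split => h /Ce.
have := @pgauss2_shift_even (~` C) m1 m2 (measurableC mC) Cc.
have -> : [set u : R * R | (~` C) (m1 + u.1, m2 + u.2)] = ~` D by [].
rewrite !pgauss2_setC//.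
have := expR_ge1Dx (- ((m1 ^+ 2 + m2 ^+ 2) / 2)).
have e1 : expR (- ((m1 ^+ 2 + m2 ^+ 2) / 2)) <= 1.
  by rewrite -expR0 ler_expR oppr_le0 divr_ge0// addr_ge0 ?sqr_ge0.
have -> : [set u : R * R | C (m1 + b11 * u.1, m2 + (b21 * u.1 + b22 * u.2))] =
  [set u : R * R | D (b11 * u.1, b21 * u.1 + b22 * u.2)] by [].
have b12 : b11 * b22 <= 1.
  exact: contraction_det_le1 bB.
move=> te h2.
exact: affine_even_arith e1 h1 (pgauss2_le1 mC) (pgauss2_le1 mE) b12 te h2 (pgauss2_ge0 _).
Qed.

Definition mkvec (a b c d : R) : vec := ((a, b), (c, d)).

Lemma gauss2_fst (f : R -> \bar R) : (forall x, 0 <= f x)%E ->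
  gauss2 (fun z => f z.1) = (\int[gam]_x f x)%E.
Proof.
move=> f0; rewrite /gauss2; apply: eq_integral => x _ /=.
transitivity (f x * gam setT)%E; first exact: integral_cst.
by rewrite probability_setT mule1.
Qed.

Lemma gauss2_snd (f : R -> \bar R) :
  gauss2 (fun z => f z.2) = (\int[gam]_x f x)%E.
Proof.
rewrite /gauss2 /=.
transitivity ((\int[gam]_x f x) * gam setT)%E; first exact: integral_cst.
by rewrite probability_setT mule1.
Qed.

(** The expectation over [W] with [U] fixed: [z.1] is [U] and [z.2] is the shift [M^T U]. The factor
    for [U] in [C] is kept on the main term, so that integrating over [U] produces the square of
    [pgauss2 C]. *)
Lemma gauss2_even_pair (C : set (R * R)) (b11 b21 b22 : R) (z : vec) :
  measurable C -> (forall x y, C (- x, - y) <-> C (x, y)) ->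
  0 <= b11 -> 0 <= b22 ->
  (forall x y, (b11 * x) ^+ 2 + (b21 * x + b22 * y) ^+ 2 <= x ^+ 2 + y ^+ 2) ->
  (gauss_ops ([:: mkvec 0 0 b11 b21; mkvec 0 0 0 b22])%R (indic (C `*` C)) z <=
   (pgauss2 C + (1 - b11 * b22))%:E * (\1_C z.1)%:E + ((z.2.1 ^+ 2 + z.2.2 ^+ 2) / 2)%:E)%E.
Proof.
move=> mC Ce b1 b2 bB.
have b12 := contraction_det_le1 bB.
pose Q := [set u : R * R | C (z.2.1 + b11 * u.1, z.2.2 + (b21 * u.1 + b22 * u.2))].
have mQ : measurable Q.
  have := @measurable_lin_set C b11 0 z.2.1 b21 b22 z.2.2 mC.
  by under eq_set do rewrite mul0r addr0 addrC [X in (_, X)]addrC.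
have -> : gauss_ops ([:: mkvec 0 0 b11 b21; mkvec 0 0 0 b22])%R (indic (C `*` C)) z =
    gauss2 (fun u => (\1_C z.1)%:E * (\1_Q u)%:E)%E.
  rewrite /gauss_ops/= /gauss_op /gauss2; apply: eq_integral => x _; apply: eq_integral => y _.
  rewrite -EFinM !indicE -natrM mulnb; congr ((_ : bool)%:R%:E).
  have E : z + x *: mkvec 0 0 b11 b21 + y *: mkvec 0 0 0 b22 =
    (z.1, (z.2.1 + b11 * x, z.2.2 + (b21 * x + b22 * y))).
    case: z {Q mQ} => [[z1 z2] [z3 z4]] /=.
    rewrite /mkvec; congr (((_, _), (_, _))) => /=; rewrite /GRing.scale/=; ring.
  rewrite E; apply/idP/andP => [|[]]; rewrite !inE//=.
rewrite gauss2Zl//; last exact: measurable_indicE.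
rewrite (gauss2_indic mQ) (gam2_pgauss2 mQ) -!EFinM -EFinD lee_fin.
have [zC|zC] := boolP (z.1 \in C); rewrite indicE ?zC ?(negbTE zC).
  rewrite mul1r mulr1; exact: pgauss2_affine_even.
by rewrite mul0r mulr0 add0r divr_ge0// addr_ge0 ?sqr_ge0.
Qed.

Lemma gauss_ops_even_pair (C : set (R * R)) (m11 m12 m21 m22 b11 b21 b22 : R) :
  measurable C -> (forall x y, C (- x, - y) <-> C (x, y)) ->
  0 <= b11 -> 0 <= b22 ->
  m11 ^+ 2 + m21 ^+ 2 + b11 ^+ 2 = 1 ->
  m12 ^+ 2 + m22 ^+ 2 + (b21 ^+ 2 + b22 ^+ 2) = 1 ->
  m11 * m12 + m21 * m22 + b11 * b21 = 0 ->
  (gauss_ops ([:: mkvec 1 0 m11 m12; mkvec 0 1 m21 m22;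
                 mkvec 0 0 b11 b21; mkvec 0 0 0 b22])%R (indic (C `*` C)) 0%R <=
   (pgauss2 C ^+ 2 + 7 * (m11 ^+ 2 + m21 ^+ 2 + (m12 ^+ 2 + m22 ^+ 2)))%:E)%E.
Proof.
move=> mC Ce b1 b2 h33 h44 h34.
have bB := cholesky_contraction h33 h44 h34.
have dT := cholesky_det h33 h44 h34 b1 b2.
have sT := cholesky_shift m11 m12 m21 m22.
set T := m11 ^+ 2 + m21 ^+ 2 + (m12 ^+ 2 + m22 ^+ 2) in dT sT *.
have T0 : 0 <= T by rewrite /T !addr_ge0 ?sqr_ge0.
have mCC : measurable_fun setT (indic (C `*` C)).
  by apply: measurable_indicE; exact: measurableX.
set c1 : vec := mkvec 1 0 m11 m12; set c2 : vec := mkvec 0 1 m21 m22.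
set cs : seq vec := ([:: mkvec 0 0 b11 b21; mkvec 0 0 0 b22])%R.
have mK := measurable_gauss_ops cs mCC (indicE_ge0 _).
have K0 z := gauss_ops_ge0 cs z (indicE_ge0 (C `*` C)).
have KE : forall z, (gauss_ops cs (indic (C `*` C)) z <= _)%E := fun z => gauss2_even_pair z mC Ce b1 b2 bB.
move: mK K0 KE.
have -> : gauss_ops (c1 :: c2 :: cs) (indic (C `*` C)) 0%R =
  gauss2 (fun x => gauss_ops cs (indic (C `*` C)) (0 + x.1 *: c1 + x.2 *: c2)%R) by [].
move: (gauss_ops cs (indic (C `*` C))) => K mK K0 KE.
have mI := measurable_indicE mC.
have mS1 : measurable_fun setT (fun z : R * R => (z.1 ^+ 2)%:E).
  by apply/measurable_EFinP; exact: measurable_funX.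
have mS2 : measurable_fun setT (fun z : R * R => (z.2 ^+ 2)%:E).
  by apply/measurable_EFinP; exact: measurable_funX.
pose L (z : R * R) := ((pgauss2 C + T)%:E * (\1_C z)%:E + (T / 2)%:E * ((z.1 ^+ 2)%:E + (z.2 ^+ 2)%:E))%E.
have gT0 : 0 <= pgauss2 C + T by rewrite addr_ge0// pgauss2_ge0.
have T20 : 0 <= T / 2 by rewrite divr_ge0.
have mL1 : measurable_fun setT (fun z : R * R => (pgauss2 C + T)%:E * (\1_C z)%:E)%E by exact: emeasurable_funM.
have mS : measurable_fun setT (fun z : R * R => (z.1 ^+ 2)%:E + (z.2 ^+ 2)%:E)%E by exact: emeasurable_funD.
have mL2 : measurable_fun setT (fun z : R * R => (T / 2)%:E * ((z.1 ^+ 2)%:E + (z.2 ^+ 2)%:E))%E.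
  exact: emeasurable_funM.
have S10 (z : R * R) : (0 <= (z.1 ^+ 2)%:E)%E by rewrite lee_fin sqr_ge0.
have S20 (z : R * R) : (0 <= (z.2 ^+ 2)%:E)%E by rewrite lee_fin sqr_ge0.
apply: (@le_trans _ _ (gauss2 L)).
  apply: le_gauss2.
  - apply: (measurableT_comp mK); apply: measurable_vec_comb => //.
    exact: measurable_vec_comb.
  - by move=> z; exact: K0.
  - exact: emeasurable_funD.
  move=> [x y]; apply: (le_trans (KE _)).
  have -> : 0 + x *: c1 + y *: c2 = ((x, y), (m11 * x + m21 * y, m12 * x + m22 * y)).
    by rewrite /c1 /c2 /mkvec; congr (((_, _), (_, _))) => /=; rewrite /GRing.scale/=; ring.
  rewrite /L; apply: leeD => /=.
    by rewrite lee_wpmul2r ?lee_fin// lerD2l.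
  by rewrite -EFinD lee_fin mulrAC ler_pM2r ?invr_gt0.
rewrite /L gauss2D//; last 2 first.
- by move=> z; rewrite mule_ge0// lee_fin.
- by move=> z; rewrite mule_ge0// ?adde_ge0// lee_fin.
rewrite (gauss2Zl gT0 mI (indicE_ge0 _)) (gauss2Zl T20 mS); last by move=> z; rewrite adde_ge0.
rewrite (gauss2D mS1 S10 mS2 S20) (gauss2_indic mC) (gam2_pgauss2 mC).
rewrite (gauss2_fst (f := fun x => (x ^+ 2)%:E)) ?(gauss2_snd (fun x => (x ^+ 2)%:E)); last first.
  by move=> x; rewrite lee_fin sqr_ge0.
(* The constant 7 arises here: the shift costs [T / 2 * (6 + 6) = 6 T] by the second moment bound,
   and [det B] costs [T * pgauss2 C <= T]. *)
apply: (@le_trans _ _ ((pgauss2 C + T)%:E * (pgauss2 C)%:E + (T / 2)%:E * (6%:E + 6%:E)))%E.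
  by rewrite leeD2l// lee_wpmul2l ?lee_fin// leeD// std_normal_second_moment.
rewrite -[leLHS]/(((pgauss2 C + T) * pgauss2 C + T / 2 * (6 + 6))%:E) lee_fin.
have : T * pgauss2 C <= T by rewrite ler_piMr// pgauss2_le1.
move: (pgauss2 C) (T) => g t; lra.
Qed.

End pair_bound.

Section gram.
Context {R : realType}.
Local Notation gam := (@std_normal R).
Local Notation gam2 := (gam \x gam)%E.
Local Notation vec := (R * R * (R * R))%type.
Local Notation indic C := (fun z => (\1_C z)%:E : \bar R).

Definition gram (ys : seq vec) (a b : vec -> R) : R := \sum_(y <- ys) a y * b y.

Lemma vecE (v : vec) : v = mkvec (coord1 v) (coord2 v) (coord3 v) (coord4 v).
Proof. by case: v => [[? ?] [? ?]]. Qed.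

Lemma gram4 (c1 c2 c3 c4 : vec) a b :
  gram [:: c1; c2; c3; c4] a b = a c1 * b c1 + (a c2 * b c2 + (a c3 * b c3 + a c4 * b c4)).
Proof. by rewrite /gram !big_cons big_nil addr0. Qed.

Lemma sqr_eq1 (x : R) : 0 <= x -> x * x = 1 -> x = 1.
Proof. by move=> x0 /eqP; rewrite -expr2 sqrp_eq1// => /eqP. Qed.

(** A standard first pair forces the leading two-by-two block of the triangular factor to be the
    identity. The entries below it are then the cross-covariances [M], and the remaining block is
    the Cholesky factor [B]. *)
Lemma gauss_ops_orthonormal2 (ys : seq vec) :
  gram ys coord1 coord1 = 1 -> gram ys coord1 coord2 = 0 -> gram ys coord2 coord2 = 1 ->
  exists m11 m12 m21 m22 b11 b21 b22, [/\ 0 <= b11, 0 <= b22,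
   [/\ gram ys coord1 coord3 = m11, gram ys coord1 coord4 = m12, gram ys coord2 coord3 = m21 & gram ys coord2 coord4 = m22],
   [/\ gram ys coord3 coord3 = m11 ^+ 2 + m21 ^+ 2 + b11 ^+ 2,
    gram ys coord4 coord4 = m12 ^+ 2 + m22 ^+ 2 + (b21 ^+ 2 + b22 ^+ 2) &
    gram ys coord3 coord4 = m11 * m12 + m21 * m22 + b11 * b21] &
   forall H, measurable_fun setT H -> (forall v, 0 <= H v)%E ->
     gauss_ops ys H = gauss_ops [:: mkvec 1 0 m11 m12; mkvec 0 1 m21 m22;
                 mkvec 0 0 b11 b21; mkvec 0 0 0 b22] H].
Proof.
move=> g11 g12 g22.
have [c1 [c2 [c3 [c4 [[[z12 z13 z14 z23 z24] z34] [p1 p2 p3 p4] gr op]]]]] := gauss_ops_triangular ys.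
have gE a b : linear_form a -> linear_form b -> gram ys a b = a c1 * b c1 + (a c2 * b c2 + (a c3 * b c3 + a c4 * b c4)).
  by move=> la lb; rewrite -gram4 /gram gr.
have u1 : coord1 c1 = 1.
  apply: sqr_eq1 => //; rewrite -g11 gE; [|exact: coord1_lin|exact: coord1_lin].
  by rewrite z12 z13 z14 !mul0r !addr0.
have u2 : coord2 c1 = 0.
  rewrite -g12 gE; [|exact: coord1_lin|exact: coord2_lin].
  by rewrite u1 z12 z13 z14 !mul0r !addr0 mul1r.
have u3 : coord2 c2 = 1.
  apply: sqr_eq1 => //; rewrite -g22 gE; [|exact: coord2_lin|exact: coord2_lin].
  by rewrite u2 z23 z24 !mul0r !addr0 add0r.
exists (coord3 c1), (coord4 c1), (coord3 c2), (coord4 c2), (coord3 c3), (coord4 c3), (coord4 c4).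
split; [exact: p3|exact: p4|split|split|].
- rewrite gE; [|exact: coord1_lin|exact: coord3_lin].
  by rewrite u1 z12 z13 z14 !mul0r !addr0 mul1r.
- rewrite gE; [|exact: coord1_lin|exact: coord4_lin].
  by rewrite u1 z12 z13 z14 !mul0r !addr0 mul1r.
- rewrite gE; [|exact: coord2_lin|exact: coord3_lin].
  by rewrite u2 u3 z23 z24 !mul0r !addr0 mul1r add0r.
- rewrite gE; [|exact: coord2_lin|exact: coord4_lin].
  by rewrite u2 u3 z23 z24 !mul0r !addr0 mul1r add0r.
- rewrite gE; [|exact: coord3_lin|exact: coord3_lin].
  by rewrite z34 mul0r addr0 -!expr2 addrA.
- by rewrite gE; [rewrite -!expr2 addrA|exact: coord4_lin|exact: coord4_lin].
- rewrite gE; [|exact: coord3_lin|exact: coord4_lin].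
  by rewrite z34 mul0r addr0 addrA.
- move=> H mH H0; rewrite (op _ mH H0).
  by rewrite [c1]vecE [c2]vecE [c3]vecE [c4]vecE u1 u2 u3 z12 z13 z14 z23 z24 z34.
Qed.

Lemma gauss_ops_pair_upper (ys : seq vec) (C : set (R * R)) :
  measurable C -> (forall x y, C (- x, - y) <-> C (x, y)) ->
  gram ys coord1 coord1 = 1 -> gram ys coord1 coord2 = 0 -> gram ys coord2 coord2 = 1 ->
  gram ys coord3 coord3 = 1 -> gram ys coord3 coord4 = 0 -> gram ys coord4 coord4 = 1 ->
  (gauss_ops ys (indic (C `*` C)) 0%R <=
   (pgauss2 C ^+ 2 + 7 * (gram ys coord1 coord3 ^+ 2 + gram ys coord2 coord3 ^+ 2 +
     (gram ys coord1 coord4 ^+ 2 + gram ys coord2 coord4 ^+ 2)))%:E)%E.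
Proof.
move=> mC Ce g11 g12 g22 g33 g34 g44.
have [m11 [m12 [m21 [m22 [b11 [b21 [b22 [b1 b2 [-> -> -> ->] [h33 h44 h34] op]]]]]]]] :=
  gauss_ops_orthonormal2 g11 g12 g22.
have mCC : measurable_fun setT (indic (C `*` C) : vec -> \bar R).
  by apply: measurable_indicE; exact: measurableX.
rewrite (op _ mCC (indicE_ge0 _)).
apply: gauss_ops_even_pair => //.
- by rewrite -h33.
- by rewrite -h44.
- by rewrite -h34.
Qed.

Lemma gauss_ops_fst (ys : seq vec) (C : set (R * R)) : measurable C ->
  gram ys coord1 coord1 = 1 -> gram ys coord1 coord2 = 0 -> gram ys coord2 coord2 = 1 ->
  gauss_ops ys (indic (C `*` setT)) 0%R = gam2 C.
Proof.
move=> mC g11 g12 g22.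
have [m11 [m12 [m21 [m22 [b11 [b21 [b22 [_ _ _ _ op]]]]]]]] :=
  gauss_ops_orthonormal2 g11 g12 g22.
have mCT : measurable_fun setT (indic (C `*` setT) : vec -> \bar R).
  by apply: measurable_indicE; exact: measurableX.
rewrite (op _ mCT (indicE_ge0 _)).
(* The two vectors carrying [B] move only the second pair, so they act trivially on an event about
   the first. *)
have cst_op (c d : R) : gauss_op (mkvec 0 0 c d) (indic (C `*` setT)) = indic (C `*` setT).
  apply/funext => z; rewrite /gauss_op.
  transitivity (\int[gam]_x (\1_(C `*` setT) z)%:E)%E.
    apply: eq_integral => x _; rewrite !indicE; congr ((_ : bool)%:R%:E).
    have E : (z + x *: mkvec 0 0 c d).1 = z.1.
      by rewrite /= scaler0 addr0.
    by apply/idP/idP; rewrite !inE /setX /mkset E.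
  transitivity ((\1_(C `*` setT) z)%:E * gam setT)%E; first exact: integral_cst.
  by rewrite probability_setT mule1.
rewrite !gauss_ops_cons /gauss_ops/= !cst_op -(gauss2_indic mC) /gauss2 /gauss_op.
apply: eq_integral => x _; apply: eq_integral => y _.
rewrite !indicE; congr ((_ : bool)%:R%:E).
have E : (0 + x *: mkvec 1 0 m11 m12 + y *: mkvec 0 1 m21 m22).1 = (x, y) :> R * R.
  by congr (_, _) => /=; rewrite /GRing.scale/=; ring.
apply/idP/idP; rewrite !inE /setX /mkset E //; by case.
Qed.

(* Since [sgn 0 = 1], the wedge itself is not invariant under [u -> -u]; its closure
   is, and has the same Gaussian measure. *)
Lemma closed_opposite_cone (t : R) :
  let C := [set u : R * R | u.1 * (cos t * u.1 + sin t * u.2) <= 0] in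
  [/\ measurable C, forall x y, C (- x, - y) <-> C (x, y), wedge t `<=` C &
    0 <= t <= pi -> pgauss2 C = t / pi].
Proof.
move=> C.
have mC : measurable C.
  rewrite (_ : C = setT `&` (fun u : R * R => u.1 * (cos t * u.1 + sin t * u.2)) @^-1` `]-oo, 0]%classic).
    apply: measurable_funM => //; exact: measurable_lin2_0.
  by apply/seteqP; split => u /=; rewrite /C/= in_itv/= ?setTI// => -[].
have sub : wedge t `<=` C.
  move=> u; rewrite /wedge /C/= sgn_eqE.
  have [u1|u1] := leP 0 u.1; have [v1|v1] := leP 0 (cos t * u.1 + sin t * u.2) => //= _.
    by rewrite mulr_ge0_le0// ltW.
  by rewrite mulr_le0_ge0// ltW.
split => //.
- by move=> x y; rewrite /C/= !mulrN -opprD mulrNN.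
move=> t0pi; suff E : gam2 C = gam2 (wedge t) by rewrite /pgauss2 E (gam2_wedge t0pi).
pose N1 := [set u : R * R | u.1 = 0].
pose N2 := [set u : R * R | cos t * u.1 + sin t * u.2 = 0].
have mN1 : measurable N1 := measurable_axis0.
have mN2 : measurable N2 := measurable_lin2_eq0 _ _.
rewrite -(gam2_setD0 mC mN1 gam2_axis0) -(gam2_setD0 (measurable_wedge t) mN1 gam2_axis0).
rewrite -(gam2_setD0 (measurableD mC mN1) mN2 (gam2_line0 (cos2Dsin2 t))).
rewrite -(gam2_setD0 (measurableD (measurable_wedge t) mN1) mN2 (gam2_line0 (cos2Dsin2 t))).
congr (gam2 _); apply/seteqP; split => u [[Cu u1] u2]; split => //; split => //; last exact: sub.
move: Cu u1 u2; rewrite /C /N1 /N2 /wedge/= sgn_eqE.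
set v := cos t * _ + _ => Cu /eqP u1 /eqP v1.
have [a|a] := leP 0 u.1; have [b|b] := leP 0 v => //=.
  by move: Cu; rewrite leNgt mulr_gt0// lt_neqAle eq_sym ?u1 ?v1.
by move: Cu; rewrite leNgt nmulr_rgt0 ?b.
Qed.

End gram.

(** * Toeplitz rows and Rademacher signs *)

Section toeplitz_coefficients.
Context {R : realType}.
Variables (n k : nat).

(* The coefficient of [g_l] in [(P D u)_i], where [D = diag s]. *)
Definition coef (s : 'I_n -> R) (u : 'rV[R]_n) (i : 'I_k) (l : 'I_(n + k - 1)) : R :=
  \sum_(j < n) (j + k - 1 - i == l)%N%:R * (s j * u ord0 j).

Lemma toeplitz_index_lt (i : 'I_k) (j : 'I_n) : (j + k - 1 - i < n + k - 1)%N.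
Proof. have := ltn_ord i; have := ltn_ord j; lia. Qed.

Lemma sum_eq_nat (T : pzSemiRingType) m (a : nat) (f : 'I_m -> T) (am : (a < m)%N) :
  \sum_(l < m) (a == l)%N%:R * f l = f (Ordinal am).
Proof.
rewrite (bigD1 (Ordinal am))//= eqxx mul1r big1 ?addr0// => l ll.
by case: eqP => [al|_]; rewrite ?mul0r//; case/eqP: ll; apply: val_inj.
Qed.

Lemma toeplitzE (g : 'I_(n + k - 1) -> R) (i : 'I_k) (j : 'I_n) :
  toeplitz g i j = \sum_(l < n + k - 1) (j + k - 1 - i == l)%N%:R * g l.
Proof.
rewrite (sum_eq_nat _ (toeplitz_index_lt i j)) /toeplitz.
by rewrite (insubT (fun l => l < n + k - 1)%N (toeplitz_index_lt i j)).
Qed.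

Lemma toeplitz_coef (g : 'I_(n + k - 1) -> R) (s : 'I_n -> R) (u : 'rV[R]_n) (i : 'I_k) :
  \sum_(j < n) toeplitz g i j * s j * u ord0 j = \sum_l g l * coef s u i l.
Proof.
under eq_bigr => j _ do rewrite toeplitzE -mulrA mulr_suml.
rewrite exchange_big; apply: eq_bigr => l _; rewrite /coef mulr_sumr.
by apply: eq_bigr => j _; ring.
Qed.

(** Rows [i] and [i'] use the same Gaussian at columns [j] and [j'] exactly when [j - i = j' - i'];
    the additive form of this condition avoids truncated subtraction. *)
Lemma coef_gram (s : 'I_n -> R) u v (i i' : 'I_k) :
  \sum_l coef s u i l * coef s v i' l =
  \sum_(j < n) \sum_(j' < n) (j + i' == j' + i)%N%:R * ((s j * u ord0 j) * (s j' * v ord0 j')).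
Proof.
under eq_bigr => l _ do rewrite /coef big_distrlr/=.
rewrite exchange_big; apply: eq_bigr => j _.
rewrite exchange_big; apply: eq_bigr => j' _.
transitivity (\sum_(l < n + k - 1) (j + k - 1 - i == l)%N%:R *
  ((j' + k - 1 - i' == l)%N%:R * (s j * u ord0 j * (s j' * v ord0 j')))).
  by apply: eq_bigr => l _; ring.
rewrite (sum_eq_nat _ (toeplitz_index_lt i j)) /=; congr ((nat_of_bool _)%:R * _).
by apply/eqP/eqP => h; have := ltn_ord i; have := ltn_ord i'; lia.
Qed.

(** Within one row distinct columns use distinct Gaussians and the signs square to one. Hence each
    planar vector [U_i] is standard for every fixed choice of signs. *)
Lemma coef_gram_diag (s : 'I_n -> R) u v (i : 'I_k) : (forall j, s j ^+ 2 = 1) ->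
  \sum_l coef s u i l * coef s v i l = dotv u v.
Proof.
move=> s2; rewrite coef_gram /dotv; apply: eq_bigr => j _.
rewrite (bigD1 j)//= eqxx mul1r big1 ?addr0.
  by rewrite mulrACA -expr2 s2 mul1r.
by move=> j' j'j; rewrite eqn_add2r eq_sym (inj_eq val_inj) (negbTE j'j) mul0r.
Qed.

End toeplitz_coefficients.

Section rademacher_sums.
Variables (R : realFieldType) (n : nat).
Local Notation signs := {ffun 'I_n -> bool}.

Definition sg (e : signs) (j : 'I_n) : R := (-1) ^+ e j.

Lemma sg_sqr e j : sg e j ^+ 2 = 1. Proof. by rewrite /sg sqrr_sign. Qed.

Definition flip (a : 'I_n) (e : signs) : signs :=
  [ffun j => if j == a then ~~ e j else e j].

Lemma flipK a : involutive (flip a).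
Proof. by move=> e; apply/ffunP => j; rewrite !ffunE; case: eqP => // _; rewrite negbK. Qed.

Lemma sg_flip a e j : sg (flip a e) j = if j == a then - sg e j else sg e j.
Proof. by rewrite /sg ffunE; case: eqP => // _; rewrite signrN. Qed.

Lemma sum_flip0 a (f : signs -> R) : (forall e, f (flip a e) = - f e) -> \sum_e f e = 0.
Proof.
move=> fa; have : \sum_e f e = - \sum_e f e.
  rewrite {1}(reindex_inj (inv_inj (flipK a))) -sumrN.
  by apply: eq_bigr => e _; exact: fa.
by move: (\sum_e f e) => S; lra.
Qed.

(* For distinct pairs with the same difference of indices, some index occurs exactly
   once among the four; flipping its sign negates the product. *)
Lemma sum_sg4 (i i' : nat) (x y : 'I_n * 'I_n) : i != i' ->
  (x.1 + i' = x.2 + i)%N -> (y.1 + i' = y.2 + i)%N ->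
  \sum_e (sg e x.1 * sg e x.2) * (sg e y.1 * sg e y.2) = (2 ^ n)%:R * (x == y)%:R.
Proof.
case: x => x1 x2; case: y => y1 y2 /= ii hx hy.
have [[-> ->]|xy] := eqVneq (x1, x2) (y1, y2).
  rewrite mulr1; under eq_bigr => e _ do rewrite -expr2 exprMn !sg_sqr mulr1.
  by rewrite sumr_const card_ffun card_bool card_ord.
rewrite mulr0.
have x12 : (x2 == x1) = false by apply/eqP => h; move: hx ii; rewrite h; lia.
have y12 : (y2 == y1) = false by apply/eqP => h; move: hy ii; rewrite h; lia.
have y1x1 : (y1 == x1) = false.
  apply/eqP => h; case/eqP: xy; congr (_, _) => //; apply: val_inj; move: hx hy; rewrite h /=; lia.
have [y2x1|/negbTE y2x1] := eqVneq y2 x1.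
  apply: (@sum_flip0 x2) => e; rewrite !sg_flip eqxx eq_sym x12.
  have -> : (y1 == x2) = false by apply/eqP => h; move: hx hy ii; rewrite y2x1 h; lia.
  have -> : (y2 == x2) = false by rewrite y2x1 eq_sym x12.
  by ring.
apply: (@sum_flip0 x1) => e; rewrite !sg_flip eqxx x12 y1x1 y2x1; ring.
Qed.

(** Only the diagonal terms of the expanded square survive the sum over signs. The assumption
    [i != i'] excludes [j = j'], where the signs would multiply to a constant, and prevents
    [(j, j')] and [(j', j)] from both occurring. *)
Lemma sum_rademacher_chaos (i i' : nat) (a b : 'I_n -> R) : i != i' ->
  \sum_e (\sum_(j < n) \sum_(j' < n)
     (j + i' == j' + i)%N%:R * ((sg e j * a j) * (sg e j' * b j'))) ^+ 2 =
  (2 ^ n)%:R * \sum_(j < n) \sum_(j' < n) (j + i' == j' + i)%N%:R * (a j ^+ 2 * b j' ^+ 2).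
Proof.
move=> ii.
pose A (x : 'I_n * 'I_n) : R := (x.1 + i' == x.2 + i)%N%:R * (a x.1 * b x.2).
transitivity (\sum_e \sum_x \sum_y (A x * (sg e x.1 * sg e x.2)) * (A y * (sg e y.1 * sg e y.2))).
  apply: eq_bigr => e _; rewrite -big_distrlr/= -expr2; congr (_ ^+ 2).
  rewrite (pair_big xpredT xpredT) /=; apply: eq_bigr => x _; rewrite /A; ring.
rewrite exchange_big /= [in RHS](pair_big xpredT xpredT) /= mulr_sumr; apply: eq_bigr => x _.
rewrite exchange_big /= (bigD1 x)//= [X in _ + X]big1 ?addr0.
  rewrite /A; case: eqP => [hx|_]; last first.
    by rewrite big1 ?mul0r ?mulr0// => e _; rewrite !mul0r.
  rewrite (_ : true%:R = 1 :> R)// -[RHS]mulr1 -[X in _ = _ * X](_ : (x == x)%:R = 1); last by rewrite eqxx.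
  transitivity ((a x.1 * b x.2) ^+ 2 * \sum_e (sg e x.1 * sg e x.2) * (sg e x.1 * sg e x.2)).
    by rewrite mulr_sumr; apply: eq_bigr => e _; ring.
  rewrite (sum_sg4 ii hx hx); ring.
move=> y yx.
rewrite /A; case: (eqVneq (x.1 + i')%N (x.2 + i)%N) => [hx|_]; last first.
  by rewrite big1// => e _; rewrite !mul0r.
case: (eqVneq (y.1 + i')%N (y.2 + i)%N) => [hy|_]; last first.
  by rewrite big1// => e _; rewrite !mul0r mulr0.
rewrite (_ : true%:R = 1 :> R)//.
transitivity ((a x.1 * b x.2) * (a y.1 * b y.2) * \sum_e (sg e x.1 * sg e x.2) * (sg e y.1 * sg e y.2)).
  by rewrite mulr_sumr; apply: eq_bigr => e _; ring.
by rewrite (sum_sg4 ii hx hy) eq_sym (negbTE yx) !mulr0.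
Qed.

(** Given [i], [j] and [j'], at most one [i'] satisfies [j + i' = j' + i], so summing over [i']
    counts each product at most once. *)
Lemma sum_shift_le (k : nat) (i : 'I_k) (a b : 'I_n -> R) :
  \sum_(i' < k) \sum_(j < n) \sum_(j' < n) (j + i' == j' + i)%N%:R * (a j ^+ 2 * b j' ^+ 2)
  <= (\sum_(j < n) a j ^+ 2) * (\sum_(j < n) b j ^+ 2).
Proof.
rewrite exchange_big big_distrl /=; apply: ler_sum => j _.
rewrite exchange_big big_distrr /=; apply: ler_sum => j' _.
rewrite -mulr_suml; apply: ler_piMl; first by apply: mulr_ge0; exact: sqr_ge0.
have [/existsP[i0 /eqP h0]|/existsPn h] := boolP [exists i' : 'I_k, (j + i' == j' + i)%N].
  rewrite (bigD1 i0)//= h0 eqxx big1 ?addr0// => i1 i10.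
  case: eqP => // h1; case/eqP: i10; apply: val_inj => /=.
  by move: h1; rewrite -h0 => /eqP; rewrite eqn_add2l => /eqP.
by rewrite big1 ?ler01// => i1 _; rewrite (negbTE (h i1)).
Qed.

End rademacher_sums.

(** * Planar decomposition of two unit vectors *)

(** Gram-Schmidt: [r - c p] has squared norm [1 - c^2 = sin^2], so dividing by the sine gives [q].
    Parallel vectors need a separate choice of [q]. *)
Lemma orthonormal_complement (R : realType) (n : nat) (p r : 'rV[R]_n) : (2 <= n)%N ->
  dotv p p = 1 -> dotv r r = 1 ->
  0 <= angle p r <= pi /\ exists q : 'rV[R]_n, [/\ dotv q q = 1, dotv p q = 0 &
    forall j, r ord0 j = cos (angle p r) * p ord0 j + sin (angle p r) * q ord0 j].
Proof.
move=> n2 pp rr; set c := dotv p r.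
have dotvD (a b x y : R) (u v : 'rV[R]_n) : dotv (a *: u + b *: v) (x *: u + y *: v) =
   a * x * dotv u u + (a * y + b * x) * dotv u v + b * y * dotv v v.
  rewrite /dotv !mulr_sumr -!big_split; apply: eq_bigr => j _ /=; rewrite !mxE; ring.
have dot_ge0 (u : 'rV[R]_n) : 0 <= dotv u u.
  by apply: sumr_ge0 => j _; rewrite -expr2 sqr_ge0.
have dot_eq0 (u : 'rV[R]_n) : dotv u u = 0 -> forall j, u ord0 j = 0.
  move/eqP; rewrite psumr_eq0; last by move=> j _; rewrite -expr2 sqr_ge0.
  by move=> /allP h j; have := h j (mem_index_enum _); rewrite /= mulf_eq0 orbb => /eqP.
have res : dotv ((- c) *: p + 1 *: r) ((- c) *: p + 1 *: r) = 1 - c ^+ 2.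
  rewrite dotvD pp rr -/c; ring.
have c2 : c ^+ 2 <= 1 by rewrite -subr_ge0 -res.
have c1 : -1 <= c <= 1 by rewrite -ler_norml -(@ler_sqr _ `|c|) ?nnegrE// expr1n real_normK ?num_real.
have cosE : cos (angle p r) = c by rewrite /angle acosK// in_itv.
have sin2 : sin (angle p r) ^+ 2 = 1 - c ^+ 2 by rewrite -cosE -(cos2Dsin2 (angle p r)) addrC addKr.
split; first by rewrite /angle acos_ge0// acos_lepi.
have [s0|s0] := eqVneq (sin (angle p r)) 0.
  have : 1 - c ^+ 2 = 0 by rewrite -sin2 s0 expr0n.
  rewrite -res => /dot_eq0 rE.
  (* Here [r = c p], and any unit vector orthogonal to [p] will do. It is found by a quarter-turn of
     the first two coordinates of [p], or as a basis vector if both vanish; this is where [n >= 2]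
     enters. *)
  have [q [qq pq]] : exists q : 'rV[R]_n, dotv q q = 1 /\ dotv p q = 0.
    have n0 : (0 < n)%N by lia.
    pose j0 : 'I_n := Ordinal n0; pose j1 : 'I_n := Ordinal n2.
    have j10 : (j1 == j0) = false by [].
    pose a := p ord0 j0; pose b := p ord0 j1.
    have [ab|ab] := eqVneq (a ^+ 2 + b ^+ 2) 0.
      have a0 : a = 0.
        by move/eqP: ab; rewrite paddr_eq0 ?sqr_ge0// !sqrf_eq0 => /andP[/eqP].
      exists (\row_j (j == j0)%:R); split; rewrite /dotv (bigD1 j0)//= !mxE eqxx big1 ?addr0.
      - by rewrite mulr1.
      - by move=> j /negbTE jj; rewrite !mxE jj mul0r.
      - by rewrite mulr1.
      - by move=> j /negbTE jj; rewrite !mxE jj mulr0.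
    pose w : 'rV[R]_n := \row_j (if j == j0 then - b else if j == j1 then a else 0).
    have sumw (f : 'I_n -> R) : (forall j, j != j0 -> j != j1 -> f j = 0) -> \sum_j f j = f j0 + f j1.
      move=> f0; rewrite (bigD1 j0)//= (bigD1 j1)//= big1 ?addr0//.
      by move=> j /andP[h1 h2]; exact: f0.
    have ww : dotv w w = a ^+ 2 + b ^+ 2.
      rewrite /dotv sumw; first by rewrite !mxE eqxx j10 eqxx; ring.
      by move=> j /negbTE h1 /negbTE h2; rewrite !mxE h1 h2 mul0r.
    have pw : dotv p w = 0.
      rewrite /dotv sumw; first by rewrite !mxE eqxx j10 eqxx -/a -/b; ring.
      by move=> j /negbTE h1 /negbTE h2; rewrite !mxE h1 h2 mulr0.
    pose t := Num.sqrt (a ^+ 2 + b ^+ 2).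
    have t2 : t ^+ 2 = a ^+ 2 + b ^+ 2 by rewrite sqr_sqrtr// addr_ge0 ?sqr_ge0.
    have t0 : t ^+ 2 != 0 by rewrite t2.
    exists (t^-1 *: w); split.
      have -> : dotv (t^-1 *: w) (t^-1 *: w) = (t ^+ 2)^-1 * dotv w w.
        rewrite /dotv mulr_sumr; apply: eq_bigr => j _; rewrite !mxE -exprVn; ring.
      by rewrite ww -t2 mulVf.
    have -> : dotv p (t^-1 *: w) = t^-1 * dotv p w.
      rewrite /dotv mulr_sumr; apply: eq_bigr => j _; rewrite !mxE; ring.
    by rewrite pw mulr0.
  exists q; split => // j; rewrite s0 mul0r addr0 cosE.
  by have := rE j; rewrite !mxE mul1r mulNr addrC => /subr0_eq.
set s := sin _.
exists (s^-1 *: ((- c) *: p + 1 *: r)); split.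
- have -> : dotv (s^-1 *: ((- c) *: p + 1 *: r)) (s^-1 *: ((- c) *: p + 1 *: r)) =
    (s ^+ 2)^-1 * dotv ((- c) *: p + 1 *: r) ((- c) *: p + 1 *: r).
    rewrite /dotv mulr_sumr; apply: eq_bigr => j _; rewrite !mxE -exprVn; ring.
  by rewrite res -sin2 mulVf// expf_eq0.
- have -> : dotv p (s^-1 *: ((- c) *: p + 1 *: r)) = s^-1 * (- c * dotv p p + dotv p r).
    rewrite /dotv mulrDr !mulr_sumr -big_split; apply: eq_bigr => j _ /=; rewrite !mxE; ring.
  by rewrite pp mulr1 addNr mulr0.
- move=> j; rewrite !mxE cosE mulVKf// mul1r mulNr; ring.
Qed.

(** * The short hashing model *)

Section finite_events.
Context d (Omega : measurableType d) (R : realType) (P : probability Omega R).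

(** The events are disjoint of total mass one but may miss a null set: a Rademacher variable takes
    the values 1 and -1 only almost surely. *)
Lemma probability_partition (T : finType) (F : T -> set Omega) (A : set Omega) :
  (forall e, measurable (F e)) -> (forall e e', F e `&` F e' !=set0 -> e = e') ->
  (\sum_e P (F e) = 1)%E -> measurable A -> P A = (\sum_e P (F e `&` A))%E.
Proof.
move=> mF dF F1 mA; pose I := [set` index_enum T]; pose U := \bigcup_(e in I) F e.
have tF : trivIset I F by move=> e e' _ _; exact: dF.
have finT : finite_set I by exact: finite_seq.
have mU : measurable U by exact: fin_bigcup_measurable.
have PU : P U = 1%E.
  by rewrite /U measure_fin_bigcup// -fsbig_seq ?index_enum_uniq.
have PUc : P (~` U) = 0%E by rewrite probability_setC// PU subee.
have -> : P A = (P (A `\` U) + P (A `&` U))%E by rewrite -measureDI.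
have -> : P (A `\` U) = 0%E.
  by apply: (subset_measure0 (measurableD mA mU) (measurableC mU)).
rewrite add0e setIC /U setI_bigcupl measure_fin_bigcup//.
- by rewrite -fsbig_seq ?index_enum_uniq.
- by move=> e e' _ _ [w [[Fe _] [Fe' _]]]; apply: dF; exists w.
- by move=> e _; exact: measurableI.
Qed.

Lemma integral_sum_indic (I : finType) (A : I -> set Omega) :
  (forall i, measurable (A i)) ->
  (\int[P]_w (\sum_i \1_(A i) w)%:E = \sum_i P (A i))%E.
Proof.
move=> mA; under eq_integral do rewrite -sumEFin.
rewrite ge0_integral_sum//; last first.
  by move=> i; apply/measurable_EFinP; exact: measurable_indic.
by apply: eq_bigr => i _; rewrite integral_indic// setIT.
Qed.

Lemma chebyshev_sum_indic (I : finType) (A : I -> set Omega) (m v a : R) :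
  (forall i, measurable (A i)) -> 0 < a -> 0 <= m ->
  (forall i, P (A i) = m%:E) ->
  (\sum_i \sum_j P (A i `&` A j) <= ((#|I|%:R * m) ^+ 2 + v)%:E)%E ->
  (P [set w | (a <= `|\sum_i \1_(A i) w - #|I|%:R * m|)%R] <= (v / a ^+ 2)%:E)%E.
Proof.
move=> mA a0 m0 PA PAA; set K := #|I|%:R * m; pose S w : R := \sum_i \1_(A i) w.
have K0 : 0 <= K by rewrite mulr_ge0.
have S0 w : 0 <= S w by apply: sumr_ge0.
have mS : measurable_fun setT S.
  by apply: measurable_sum => i; exact: measurable_indic.
have mSK : measurable_fun setT (fun w => (S w - K) ^+ 2).
  by apply: measurable_funX; exact: measurable_funB.
set E := [set w | _].
have mE : measurable E.
  rewrite (_ : E = setT `&` (fun w => `|S w - K|) @^-1` `[a, +oo[%classic).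
    by apply: measurableT_comp => //; exact: measurable_funB.
  by apply/seteqP; split => w /=; rewrite in_itv/= andbT ?setTI// => -[].
pose V := (\int[P]_w ((S w - K) ^+ 2)%:E)%E.
have V0 : (0 <= V)%E by apply: integral_ge0 => w _; rewrite lee_fin sqr_ge0.
have EV : ((a ^+ 2)%:E * P E <= V)%E.
  have -> : ((a ^+ 2)%:E * P E = \int[P]_w ((a ^+ 2)%:E * (\1_E w)%:E))%E.
    rewrite ge0_integralZl ?lee_fin ?sqr_ge0// ?integral_indic ?setIT//.
    by apply/measurable_EFinP; exact: measurable_indic.
  apply: ge0_le_integral => //.
  - by move=> w _; rewrite -EFinM lee_fin mulr_ge0// sqr_ge0.
  - by apply: emeasurable_funM => //; apply/measurable_EFinP; exact: measurable_indic.
  - exact/measurable_EFinP.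
  move=> w _; rewrite -EFinM lee_fin indicE.
  have [wE|_] := boolP (w \in E); last by rewrite mulr0 sqr_ge0.
  rewrite mulr1 -[leRHS]real_normK ?num_real// ler_sqr ?nnegrE ?(ltW a0)//.
  by move: wE; rewrite inE.
have IS : (\int[P]_w (S w)%:E = K%:E)%E.
  rewrite integral_sum_indic//; under eq_bigr do rewrite PA.
  by rewrite sumEFin sumr_const /K mulr_natl.
have IS2 : (\int[P]_w ((S w) ^+ 2)%:E = \sum_i \sum_j P (A i `&` A j))%E.
  rewrite (pair_big xpredT xpredT)/= -(@integral_sum_indic _ (fun x => A x.1 `&` A x.2)); last first.
    by move=> x; exact: measurableI.
  apply: eq_integral => w _; congr EFin; rewrite /S expr2 big_distrlr (pair_big xpredT xpredT)/=.
  by apply: eq_bigr => x _; rewrite indicI.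
(* Expanding the square in this form keeps every term nonnegative. *)
have key : (V + (2 * K)%:E * K%:E = \sum_i \sum_j P (A i `&` A j) + (K ^+ 2)%:E)%E.
  rewrite -IS -IS2 -ge0_integralZl//; last 3 first.
  - exact/measurable_EFinP.
  - by move=> w _; rewrite lee_fin.
  - by rewrite lee_fin mulr_ge0.
  have -> : (K ^+ 2)%:E = (\int[P]_w (K ^+ 2)%:E)%E.
    transitivity ((K ^+ 2)%:E * P setT)%E; first by rewrite probability_setT mule1.
    by rewrite integral_cst.
  rewrite /V -ge0_integralD//; last 4 first.
  - by move=> w _; rewrite lee_fin sqr_ge0.
  - exact/measurable_EFinP.
  - by move=> w _; rewrite -EFinM lee_fin !mulr_ge0.
  - by apply: emeasurable_funM => //; exact/measurable_EFinP.
  rewrite -ge0_integralD//; last 3 first.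
  - by move=> w _; rewrite lee_fin sqr_ge0.
  - by apply/measurable_EFinP; exact: measurable_funX.
  - by move=> w _; rewrite lee_fin sqr_ge0.
  by apply: eq_integral => w _; rewrite -EFinM -!EFinD; congr EFin; ring.
have Vv : (V <= v%:E)%E.
  have : (V + (2 * K * K)%:E <= (K ^+ 2 + v + K ^+ 2)%:E)%E.
    by rewrite EFinM key EFinD leeD2r.
  case: V V0 {EV key} => [x| |]//= _; rewrite ?leye_eq//.
  by rewrite -EFinD !lee_fin; lra.
have a2 : 0 < a ^+ 2 by rewrite exprn_gt0.
rewrite mulrC EFinM lee_pdivlMl//.
exact: le_trans EV Vv.
Qed.

End finite_events.

Lemma lin_sum (R : realType) (a : R * R * (R * R) -> R) (I : Type) (s : seq I)
    (f : I -> R) (v : I -> R * R * (R * R)) : linear_form a ->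
  a (\sum_(i <- s) f i *: v i) = \sum_(i <- s) f i * a (v i).
Proof.
move=> la; elim: s => [|i s IH].
  by rewrite !big_nil; have := la 0 0 0 0; rewrite !scale0r addr0 !mul0r addr0.
by rewrite !big_cons -[X in a (_ + X)]scale1r la mul1r IH.
Qed.

Section model_law.
Context {R : realType} (d : measure_display) (Omega : measurableType d)
  (P : probability Omega R) (n k : nat).
Variables (g : 'I_(n + k - 1) -> {RV P >-> R}) (D : 'I_n -> {RV P >-> R}).
Let X (s : 'I_(n + k - 1) + 'I_n) : {RV P >-> R} :=
  match s with inl l => g l | inr j => D j end.
Hypothesis gaussg : forall l, std_gaussian (g l).
Hypothesis radD : forall j, rademacher (D j).
Hypothesis indep : mutually_independent X.
Local Notation vec := (R * R * (R * R))%type.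
Local Notation signs := {ffun 'I_n -> bool}.
Local Notation gs w := (fun l => g l w).
Local Notation Ds w := (fun j => D j w).

(** The value [setT] at the Gaussian indices makes [sign_event] a cylinder leaving them free, as
    [lincomb_law] requires. *)
Definition sign_box (e : signs) (s : 'I_(n + k - 1) + 'I_n) : set R :=
  match s with inl _ => setT | inr j => [set sg R e j] end.

Definition sign_event (e : signs) : set Omega := cylinder X (sign_box e).

Lemma measurable_sign_box e s : measurable (sign_box e s).
Proof. by case: s => [l|j]; rewrite /sign_box. Qed.

Lemma measurable_sign_event e : measurable (sign_event e).
Proof. by apply: measurable_cylinder => s; exact: measurable_sign_box. Qed.

Lemma sign_eventP e w : sign_event e w -> forall j, D j w = sg R e j.
Proof. by move=> ew j; have := ew (inr j) Logic.I. Qed.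

Lemma sign_event_inj e e' : sign_event e `&` sign_event e' !=set0 -> e = e'.
Proof.
move=> [w [/sign_eventP we /sign_eventP we']]; apply/ffunP => j.
by have := we j; rewrite we' /sg => /signr_inj.
Qed.

Lemma sign_event_prob e : P (sign_event e) = ((2 ^ n)%:R^-1)%:E.
Proof.
rewrite /sign_event /cylinder indep; last by move=> s; exact: measurable_sign_box.
rewrite big_sumType /= big1 ?mul1e; last by move=> l _; rewrite preimage_setT probability_setT.
transitivity (\prod_(j < n) (2^-1 : R)%:E)%E.
  apply: eq_bigr => j _; have [h1 h2] := radD j.
  by rewrite /sg; case: (e j); [rewrite expr1 h2|rewrite expr0 h1].
by rewrite prodEFin prodr_const card_ord natrX exprVn.
Qed.

Lemma sum_signs_cst (x : R) : \sum_(e : signs) (2 ^ n)%:R^-1 * x = x.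
Proof.
rewrite sumr_const card_ffun card_bool card_ord -[LHS]mulr_natl mulrA mulfV ?mul1r//.
Qed.

Lemma sum_sign_event_prob : (\sum_(e : signs) P (sign_event e) = 1)%E.
Proof.
under eq_bigr do rewrite sign_event_prob.
rewrite sumEFin -[RHS]/(1%:E) -{2}(sum_signs_cst 1).
by congr EFin; apply: eq_bigr => e _; rewrite mulr1.
Qed.

Definition projection_vec (e : signs) (p q : 'rV[R]_n) (i i' : 'I_k)
    (s : 'I_(n + k - 1) + 'I_n) : vec :=
  if s is inl l then mkvec (coef (sg R e) p i l) (coef (sg R e) q i l)
    (coef (sg R e) p i' l) (coef (sg R e) q i' l) else 0.

Let J : seq ('I_(n + k - 1) + 'I_n) := map inl (index_enum 'I_(n + k - 1)).

Let uniqJ : uniq J.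
Proof. by rewrite map_inj_uniq ?index_enum_uniq// => x y []. Qed.

Lemma sum_inl (f : 'I_(n + k - 1) + 'I_n -> R) : \sum_(s <- J) f s = \sum_l f (inl l).
Proof. by rewrite big_map. Qed.

Lemma gram_projection e p q i i' (a b : vec -> R) :
  gram (map (projection_vec e p q i i') J) a b =
  \sum_l a (projection_vec e p q i i' (inl l)) * b (projection_vec e p q i i' (inl l)).
Proof. by rewrite /gram big_map sum_inl. Qed.

Definition row_value (u : 'rV[R]_n) (i : 'I_k) (w : Omega) : R :=
  \sum_(j < n) toeplitz (gs w) i j * D j w * u ord0 j.

(** On a sign event the coefficients of the Gaussians are deterministic, so the projected values
    coincide with a fixed linear combination, to which the law of [lincomb] applies. *)
Lemma lincomb_projection e p q i i' w : sign_event e w ->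
  lincomb X (projection_vec e p q i i') J w =
  mkvec (row_value p i w) (row_value q i w) (row_value p i' w) (row_value q i' w).
Proof.
move=> /sign_eventP we.
have rE u (i0 : 'I_k) : row_value u i0 w = \sum_l g l w * coef (sg R e) u i0 l.
  rewrite -toeplitz_coef; apply: eq_bigr => j _; by rewrite we.
have lin (a : vec -> R) : linear_form a -> a (lincomb X (projection_vec e p q i i') J w) =
    \sum_l g l w * a (projection_vec e p q i i' (inl l)).
  by move=> la; rewrite /lincomb big_map lin_sum.
by rewrite [LHS]vecE !rE lin ?lin ?lin ?lin//.
Qed.

Lemma sign_event_law e p q i i' (C : set vec) : measurable C ->
  P (sign_event e `&` (lincomb X (projection_vec e p q i i') J @^-1` C)) =
  (((2 ^ n)%:R^-1)%:E * gauss_ops (map (projection_vec e p q i i') J)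
     (fun z => (\1_C z)%:E) 0%R)%E.
Proof.
move=> mC; rewrite -(sign_event_prob e); apply: lincomb_law => //.
- by move=> s /mapP[l _ ->]; exact: gaussg.
- by move=> s; exact: measurable_sign_box.
- by move=> s /mapP[l _ ->].
Qed.

Lemma measurable_row_value u i : measurable_fun setT (row_value u i).
Proof.
apply: measurable_sum => j; apply: measurable_funM => //; apply: measurable_funM => //.
rewrite (_ : (fun w => toeplitz (gs w) i j) = g (Ordinal (toeplitz_index_lt i j)))//.
by apply/funext => w; rewrite toeplitzE (sum_eq_nat _ (toeplitz_index_lt i j)).
Qed.

Variables (p q r : 'rV[R]_n) (t : R).
Hypothesis pp : dotv p p = 1.
Hypothesis qq : dotv q q = 1.
Hypothesis pq : dotv p q = 0.
Hypothesis rE : forall j, r ord0 j = cos t * p ord0 j + sin t * q ord0 j.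
Hypothesis t0pi : 0 <= t <= pi.

Lemma row_value_r i w : row_value r i w = cos t * row_value p i w + sin t * row_value q i w.
Proof.
rewrite /row_value !mulr_sumr -big_split; apply: eq_bigr => j _ /=; rewrite rE; ring.
Qed.

Definition mismatch (i : 'I_k) : set Omega :=
  [set w | wedge t (row_value p i w, row_value q i w)].

Lemma measurable_mismatch i : measurable (mismatch i).
Proof.
rewrite -[X in measurable X]setTI.
apply: (_ : measurable_fun setT (fun w => (row_value p i w, row_value q i w))) => //.
  by apply: measurable_fun_pair; exact: measurable_row_value.
exact: measurable_wedge.
Qed.

Lemma approx_angle_mismatch w :
  approx_angle (gs w) (Ds w) p r = k%:R^-1 * \sum_(i < k) \1_(mismatch i) w.
Proof.
rewrite /approx_angle [2 * _]mulrC invfM -mulrA mulr_sumr; congr (_ * _).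
apply: eq_bigr => i _; rewrite indicE.
have hE u : short_hash (gs w) (Ds w) u i = sgn (row_value u i w) by [].
rewrite !hE row_value_r.
have -> : (w \in mismatch i) = (sgn (row_value p i w) != sgn (cos t * row_value p i w + sin t * row_value q i w)).
  by apply/idP/idP; rewrite inE /mismatch /wedge/=.
rewrite /sgn; do 2 case: ifP => _; rewrite ?subrr ?normr0 ?mulr0 ?eqxx//.
  by rewrite opprK eq_sym eqNr oner_eq0 ger0_norm// mulVf.
by rewrite eqNr oner_eq0 -opprD normrN ger0_norm// mulVf.
Qed.

Lemma mismatch_prob i : P (mismatch i) = (t / pi)%:E.
Proof.
rewrite (probability_partition measurable_sign_event sign_event_inj sum_sign_event_prob (measurable_mismatch i)).
have mW : measurable (wedge t `*` [set: R * R]) by apply: measurableX => //; exact: measurable_wedge.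
transitivity (\sum_(e : signs) ((2 ^ n)%:R^-1 * (t / pi))%:E)%E.
  apply: eq_bigr => e _.
  have -> : sign_event e `&` mismatch i =
      sign_event e `&` (lincomb X (projection_vec e p q i i) J @^-1` (wedge t `*` setT)).
    by apply/seteqP; split => w [ew]; rewrite /mismatch /= lincomb_projection// => h;
      split => //; case: h.
  rewrite sign_event_law// gauss_ops_fst.
  - by rewrite gam2_wedge// EFinM.
  - exact: measurable_wedge.
  - by rewrite gram_projection -[RHS]pp -(coef_gram_diag p p i (sg_sqr R e)).
  - by rewrite gram_projection -[RHS]pq -(coef_gram_diag p q i (sg_sqr R e)).
  - by rewrite gram_projection -[RHS]qq -(coef_gram_diag q q i (sg_sqr R e)).
by rewrite sumEFin sum_signs_cst.
Qed.

Definition chaos (e : signs) (i i' : 'I_k) (u v : 'rV[R]_n) : R :=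
  \sum_(j < n) \sum_(j' < n) (j + i' == j' + i)%N%:R * ((sg R e j * u ord0 j) * (sg R e j' * v ord0 j')).

Definition overlap (i i' : 'I_k) (u v : 'rV[R]_n) : R :=
  \sum_(j < n) \sum_(j' < n) (j + i' == j' + i)%N%:R * (u ord0 j ^+ 2 * v ord0 j' ^+ 2).

Lemma overlap_ge0 i i' u v : 0 <= overlap i i' u v.
Proof.
apply: sumr_ge0 => j _; apply: sumr_ge0 => j' _.
by apply: mulr_ge0 => //; apply: mulr_ge0; exact: sqr_ge0.
Qed.

Lemma sum_overlap_le i u v : dotv u u = 1 -> dotv v v = 1 ->
  \sum_(i' < k) overlap i i' u v <= 1.
Proof.
move=> uu vv; apply: (le_trans (sum_shift_le i (fun j => u ord0 j) (fun j => v ord0 j))).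
have E (x : 'rV[R]_n) : \sum_(j < n) x ord0 j ^+ 2 = dotv x x by apply: eq_bigr => j _; rewrite expr2.
by rewrite !E uu vv mulr1.
Qed.

Lemma mismatch_pair_prob i i' : i != i' ->
  (P (mismatch i `&` mismatch i') <= ((t / pi) ^+ 2 + 7 * (overlap i i' p p + overlap i i' q p +
    (overlap i i' p q + overlap i i' q q)))%:E)%E.
Proof.
move=> ii.
(* Only an upper bound is wanted, so the wedge may be enlarged to the symmetric closed cone of the
   same measure. *)
have [mC Ce sub GC] := closed_opposite_cone t; set C := [set u | _] in mC Ce sub GC.
have mCC : measurable (C `*` C) by exact: measurableX.
rewrite (probability_partition measurable_sign_event sign_event_inj sum_sign_event_prob
  (measurableI _ _ (measurable_mismatch i) (measurable_mismatch i'))).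
(* [T e] is [|M|^2] for the sign pattern [e]; averaging it over [e] turns each squared chaos into an
   overlap. *)
pose T e := chaos e i i' p p ^+ 2 + chaos e i i' q p ^+ 2 + (chaos e i i' p q ^+ 2 + chaos e i i' q q ^+ 2).
apply: (@le_trans _ _ (\sum_(e : signs) ((2 ^ n)%:R^-1 * ((t / pi) ^+ 2 + 7 * T e))%:E)%E).
  apply: lee_sum => e _.
  have mL : measurable (lincomb X (projection_vec e p q i i') J @^-1` (C `*` C)).
    by rewrite -[_ @^-1` _]setTI; exact: measurable_lincomb.
  apply: (@le_trans _ _ (P (sign_event e `&` (lincomb X (projection_vec e p q i i') J @^-1` (C `*` C))))).
    apply: le_measure; rewrite ?inE.
    - apply: measurableI; first exact: measurable_sign_event.
      by apply: measurableI; exact: measurable_mismatch.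
    - by apply: measurableI => //; exact: measurable_sign_event.
    move=> w [ew [wi wi']]; split => //; rewrite /= lincomb_projection//.
    by split; exact: sub.
  have gE a b : gram (map (projection_vec e p q i i') J) a b = _ := gram_projection e p q i i' a b.
  rewrite sign_event_law// EFinM lee_wpmul2l ?lee_fin ?invr_ge0//.
  have -> : (t / pi) ^+ 2 + 7 * T e = pgauss2 C ^+ 2 + 7 * (gram (map (projection_vec e p q i i') J) (@coord1 R) (@coord3 R) ^+ 2
     + gram (map (projection_vec e p q i i') J) (@coord2 R) (@coord3 R) ^+ 2 +
     (gram (map (projection_vec e p q i i') J) (@coord1 R) (@coord4 R) ^+ 2 + gram (map (projection_vec e p q i i') J) (@coord2 R) (@coord4 R) ^+ 2)).
    by rewrite GC// /T /chaos -!coef_gram !gE.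
  apply: gauss_ops_pair_upper => //.
  - by rewrite gE -[RHS]pp -(coef_gram_diag p p i (sg_sqr R e)).
  - by rewrite gE -[RHS]pq -(coef_gram_diag p q i (sg_sqr R e)).
  - by rewrite gE -[RHS]qq -(coef_gram_diag q q i (sg_sqr R e)).
  - by rewrite gE -[RHS]pp -(coef_gram_diag p p i' (sg_sqr R e)).
  - by rewrite gE -[RHS]pq -(coef_gram_diag p q i' (sg_sqr R e)).
  - by rewrite gE -[RHS]qq -(coef_gram_diag q q i' (sg_sqr R e)).
rewrite sumEFin lee_fin.
under eq_bigr do rewrite mulrDr.
rewrite big_split /= sum_signs_cst lerD2l.
have N0 : (2 ^ n)%:R != 0 :> R by rewrite pnatr_eq0 expn_eq0.
have cE u v : \sum_(e : signs) chaos e i i' u v ^+ 2 = (2 ^ n)%:R * overlap i i' u v.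
  exact: (sum_rademacher_chaos (fun j => u ord0 j) (fun j => v ord0 j) ii).
rewrite -!mulr_sumr /T !big_split /= !cE -!mulrDr mulrCA mulKf//.
Qed.

(** The constant 29 is [1 + 7 * 4] per row: at most 1 for the diagonal pair, and four overlaps whose
    sums over [i'] are at most 1 each. *)
Lemma sum_mismatch_pair_prob :
  (\sum_(i < k) \sum_(i' < k) P (mismatch i `&` mismatch i') <= ((k%:R * (t / pi)) ^+ 2 + 29 * k%:R)%:E)%E.
Proof.
pose W i i' := overlap i i' p p + overlap i i' q p + (overlap i i' p q + overlap i i' q q).
have W0 i i' : 0 <= W i i' by rewrite !addr_ge0 ?overlap_ge0.
apply: (@le_trans _ _ (\sum_(i < k) \sum_(i' < k) ((t / pi) ^+ 2 + (i == i')%:R + 7 * W i i')%:E)%E).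
  apply: lee_sum => i _; apply: lee_sum => i' _.
  have [->|ii] := eqVneq i i'.
    rewrite setIid; apply: (@le_trans _ _ 1%E).
      by rewrite probability_le1//; exact: measurable_mismatch.
    by rewrite lee_fin addrAC lerDr addr_ge0 ?sqr_ge0// mulr_ge0.
  by rewrite addr0; exact: mismatch_pair_prob.
under eq_bigr do rewrite sumEFin.
rewrite sumEFin lee_fin.
apply: (@le_trans _ _ (\sum_(i < k) (k%:R * (t / pi) ^+ 2 + 29))).
  apply: ler_sum => i _.
  have E : \sum_(i' < k) (t / pi) ^+ 2 = k%:R * (t / pi) ^+ 2 by rewrite sumr_const card_ord -[LHS]mulr_natl.
  rewrite 2!big_split /= E -addrA lerD2l.
  rewrite (bigD1 i)//= eqxx big1 ?addr0; last by move=> i' /negbTE; rewrite eq_sym => ->.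
  rewrite -mulr_sumr /W !big_split /=.
  have h1 := sum_overlap_le i pp pp; have h2 := sum_overlap_le i qq pp.
  have h3 := sum_overlap_le i pp qq; have h4 := sum_overlap_le i qq qq.
  move: h1 h2 h3 h4; move: (\sum_(_ < k) _) (\sum_(_ < k) _) (\sum_(_ < k) _) (\sum_(_ < k) _) => a b c f.
  lra.
rewrite sumr_const card_ord -[leLHS]mulr_natl.
by have -> : k%:R * (k%:R * (t / pi) ^+ 2 + 29) = (k%:R * (t / pi)) ^+ 2 + 29 * k%:R by ring.
Qed.

End model_law.

(** * The rate and the conclusion *)

(** With [b^3 = sqrt (ln k) / k], the cube of [k b^2] is [k ln k], and [ln k >= 1 - 1/k] gives
    [k ln k >= k - 1 >= 1]. *)
Lemma rate_ge (R : realType) (k : nat) : (2 <= k)%N ->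
  1 <= k%:R * powR (Num.sqrt (ln k%:R) / k%:R) (3^-1) ^+ 2 :> R.
Proof.
move=> k2; set K : R := k%:R.
have K2 : 2 <= K by rewrite ler_nat.
have K0 : 0 < K by rewrite ltr0n (leq_trans _ k2).
have lnK : 1 - K^-1 <= ln K.
  have := expR_ge1Dx (- ln K); rewrite expRN lnK ?posrE//; lra.
have iK : K * K^-1 = 1 by rewrite mulfV// gt_eqF.
have KlnK : 1 <= K * ln K.
  have : K * (1 - K^-1) <= K * ln K by rewrite ler_pM2l.
  by rewrite mulrBr mulr1 iK; lra.
have l0 : 0 <= ln K by rewrite ln_ge0//; lra.
set x := Num.sqrt (ln K) / K.
have x0 : 0 <= x by rewrite divr_ge0 ?sqrtr_ge0// ltW.
set b := powR x 3^-1.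
have b3 : b ^+ 3 = x.
  by rewrite -powR_mulrn ?powR_ge0// /b -powRrM mulVf// powRr1.
have kb0 : 0 <= K * b ^+ 2 by rewrite mulr_ge0 ?sqr_ge0// ltW.
have E : (K * b ^+ 2) ^+ 3 = K * ln K.
  have -> : (K * b ^+ 2) ^+ 3 = K ^+ 3 * (b ^+ 3) ^+ 2 by ring.
  rewrite b3 /x expr_div_n sqr_sqrtr//; field.
  by rewrite gt_eqF.
by rewrite -(@ler_pXn2r _ 3) ?nnegrE// expr1n E.
Qed.

Theorem theorem3 :
  exists C : nat, forall (R : realType) (d : measure_display)
    (Omega : measurableType d) (P : probability Omega R)
    (n k : nat) (g : 'I_(n + k - 1) -> {RV P >-> R}) (D : 'I_n -> {RV P >-> R})
    (p r : 'rV[R]_n) (c : R),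
    (2 <= k)%N -> (k <= n)%N ->
    (forall l, std_gaussian (g l)) ->
    (forall j, rademacher (D j)) ->
    mutually_independent
      (fun s : 'I_(n + k - 1) + 'I_n => match s with inl l => g l | inr j => D j end) ->
    dotv p p = 1 -> dotv r r = 1 ->
    0 < c ->
    (P [set w | (c * powR (Num.sqrt (ln k%:R) / k%:R) (3^-1) <=
          `|approx_angle (fun l => g l w) (fun j => D j w) p r - angle p r / pi|)%R ]
      <= (C%:R / c ^+ 2)%:E)%E.
Proof.
exists 29%N => R d Omega P n k g D p r c k2 kn gaussg radD indep pp rr c0.
have [t0pi [q [qq pq rE]]] := orthonormal_complement (leq_trans k2 kn) pp rr.
set t := angle p r in t0pi rE *.
set b := powR _ _.
have kb : 1 <= k%:R * b ^+ 2 := rate_ge R k2.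
have K0 : 0 < k%:R :> R by rewrite ltr0n (leq_trans _ k2).
have b0 : 0 < b.
  rewrite lt_neqAle powR_ge0 andbT; apply: contraTneq kb => <-.
  by rewrite expr0n mulr0 ler10.
(* The threshold is multiplied by [k] because Chebyshev is applied to the number of mismatches
   rather than to their mean. *)
have a0 : 0 < c * b * k%:R by rewrite !mulr_gt0.
have m0 : 0 <= t / pi by case/andP: t0pi => h _; rewrite divr_ge0// pi_ge0.
have PA i := mismatch_prob gaussg radD indep pp qq pq t0pi i.
have PAA := sum_mismatch_pair_prob gaussg radD indep pp qq pq t0pi.
have mA i := measurable_mismatch g D p q t i.
have := chebyshev_sum_indic mA a0 m0 PA; rewrite card_ord => /(_ _ PAA).
set E1 := [set w | _]; set E2 := [set w | _].
have -> : E1 = E2.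
  have scale (S m : R) : `|k%:R^-1 * S - m| * k%:R = `|S - k%:R * m|.
    rewrite -{2}(ger0_norm (ltW K0)) -normrM; congr `|_|.
    by rewrite mulrBl mulrAC mulVf ?gt_eqF// mul1r [m * _]mulrC.
  apply/seteqP; split => w; rewrite /E1 /E2 /= (approx_angle_mismatch _ _ rE) -scale.
    by rewrite ler_pM2r.
  by rewrite ler_pM2r.
move=> h; apply: (le_trans h); rewrite lee_fin.
have c2 : 0 < c ^+ 2 by rewrite exprn_gt0.
(* The last factor is the inverse of the quantity that [rate_ge] bounds below by 1. *)
have -> : 29 * k%:R / (c * b * k%:R) ^+ 2 = 29 / c ^+ 2 * (k%:R * b ^+ 2)^-1.
  by field; rewrite !gt_eqF.
apply: ler_piMr; first by rewrite divr_ge0// ltW.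
by rewrite invf_le1//; exact: lt_le_trans kb.
Qed.
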